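(* Let $X_{0-}$ be a real random variable with $\mathbb{E}|X_{0-}|<\infty$. For $x\in\mathbb{R}$, let $\underline{\Lambda}^x$ denote the minimal solution to the McKean--Vlasov equation (stated in the context) with shifted initial condition $X_{0-}+x$. Then the map $x\mapsto \underline{\Lambda}^x$ is right-continuous from $\mathbb{R}$ to $(D([-1,\infty)),\mathrm{M1})$. Moreover, as $x\uparrow 0$, $\underline{\Lambda}^x$ converges in $(D([-1,\infty)),\mathrm{M1})$ to some $\Lambda^0\in M$, which is a solution to the McKean--Vlasov equation with initial condition $X_{0-}$.
   Context: Fix $\alpha>0$. For an interval $I$, $D(I)$ is the space of càdlàg functions $I\to\mathbb{R}$. Elements $f$ of $D([0,\infty))$ carry a prescribed value $f_{0-}=f(0-)$, so a jump at time $0$ is allowed. Let $$M=\{\ell\in D([0,\infty)):\ \ell_{0-}=0,\ \ell\text{ is increasing (non-decreasing)}\}.$$ McKean--Vlasov equation: given an initial condition $X_{0-}$ (a real random variable) and a Brownian motion $B$ (started at $0$) independent of $X_{0-}$, a solution with initial data $X_{0-}$ is a function $\Lambda\in M$ such that $$X_t=X_{0-}+B_t-\Lambda_t\ (t\ge0),\qquad \tau=\inf\{t\ge0:X_t\le0\},\qquad \Lambda_t=\alpha\,\mathbb{P}(\tau\le t)\ (t\ge 0).$$ Minimal solution: for $\ell\in M$ put $X^\ell_t=X_{0-}+B_t-\ell_t$, $\tau^\ell=\inf\{t\ge0:X^\ell_t\le0\}$ and $\Gamma[\ell;X_{0-}]_t=\alpha\,\mathbb{P}(\tau^\ell\le t)$,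 $t\ge0$; let $\Gamma^n[\,\cdot\,;X_{0-}]$ be the $n$-fold iterate of $\Gamma[\,\cdot\,;X_{0-}]$. The minimal solution with initial data $X_{0-}$ is $\underline\Lambda=\lim_{n\to\infty}\Gamma^n[0;X_{0-}]$ (limit in the M1 topology described below). It is known to be a solution, and it is equivalently characterized as the unique solution $\underline\Lambda\in M$ with $\underline\Lambda_t\le\Lambda_t$ for all $t\ge0$ and every solution $\Lambda\in M$ with the same initial data. Topology: every $f\in D([0,\infty))$ is regarded as an element of $D([-1,\infty))$ by setting $f(x)=f(0-)$ for $x\in[-1,0)$. M1 denotes the Skorokhod M1 topology. $f^n\to f$ in $(D([-1,\infty)),\mathrm{M1})$ means that there is a sequence $T_N\nearrow\infty$ such that $f^n\to f$ in $(D([-1,T_N]),\mathrm{M1})$ for all $N$. For non-decreasing functions, convergence in $(D([-1,T]),\mathrm{M1})$ is equivalent to $f^n(t)\to f(t)$ for all $t$ in a dense subset of $[-1,T]$ containing $-1$ and $T$. *)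

(* Defs.v *)
From HB Require Import structures.
From mathcomp Require Import all_boot all_order all_algebra.
From mathcomp Require Import all_classical all_reals all_analysis.
Import Order.TTheory GRing.Theory Num.Theory.
Import numFieldNormedType.Exports.

Set Implicit Arguments.
Unset Strict Implicit.
Unset Printing Implicit Defensive.

Local Open Scope classical_set_scope.
Local Open Scope ring_scope.

(* An element f of D([0,oo)) with prescribed value f(0-) is represented by its
   extension to R that is constantly f(0-) on ]-oo, 0[; its restriction to
   [-1,oo[ is the element of D([-1,oo)) that the M1 topology is about. *)
Section paths.
Context {R : realType}.
Implicit Types (f g l : R -> R) (a b t : R).

Definition cadlag f : Prop :=
  forall t, f s @[s --> t^'+] --> f t /\ cvg (f s @[s --> t^'-]).

(* As l vanishes on ]-oo, 0[, monotonicity on R includes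
   l(0-) = 0 <= l(0). *)
Definition M_space : set (R -> R) :=
  [set l | [/\ cadlag l, {homo l : s t / s <= t}
             & forall t, t < 0 -> l t = 0]].

(* Skorokhod M1 metric on D([a,b]): only values on [a,b] matter, with the usual
   convention f(a-) = f(a). *)
Definition left_value a f t : R :=
  if t == a then f a else lim (f s @[s --> t^'-]).

Definition completed_graph a b f : set (R * R) :=
  [set p | a <= p.1 <= b /\
    exists2 c, 0 <= c <= 1 & p.2 = c * left_value a f p.1 + (1 - c) * f p.1].

Definition graph_le a f (p q : R * R) : Prop :=
  p.1 < q.1 \/
  p.1 = q.1 /\ `|left_value a f p.1 - p.2| <= `|left_value a f p.1 - q.2|.

Definition parametric_representation a b f (h : R -> R * R) : Prop :=
  [/\ {within `[0, 1], continuous h},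
      h @` `[0, 1] = completed_graph a b f
    & forall s t, 0 <= s -> s <= t -> t <= 1 -> graph_le a f (h s) (h t)].

(* The norm of R * R is the max norm, so the inner supremum is the maximum of
   the two uniform distances between coordinates. *)
Definition M1_dist a b f g : \bar R :=
  ereal_inf [set e | exists h k : R -> R * R,
    [/\ parametric_representation a b f h,
        parametric_representation a b g k
      & e = ereal_sup [set `|h s - k s|%:E | s in `[0, 1]]]].

(* Convergence in (D([-1,oo)), M1) along a filter F; F is \oo for sequences,
   and a one-sided neighborhood filter for one-sided limits. *)
Definition M1_cvg (I : Type) (F : set_system I) (f : I -> R -> R) g : Prop :=
  exists T : nat -> R,
    [/\ nondecreasing_seq T, T n @[n --> \oo] --> +oo
      & forall N, -1 < T N /\
          M1_dist (-1) (T N) (f i) g @[i --> F] --> 0%E].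

End paths.

Section McKean_Vlasov.
Context {R : realType} {d : measure_display} {Omega : measurableType d}.
Variable P : probability Omega R.
Implicit Types (X : Omega -> R) (B : R -> Omega -> R) (l : R -> R).

(* Mutual independence; subfamilies are covered by taking A i = setT. *)
Definition independent_rvs n (Y : 'I_n -> Omega -> R) : Prop :=
  forall A : 'I_n -> set R, (forall i, measurable (A i)) ->
    P (\big[setI/setT]_(i < n) (Y i @^-1` A i)) =
    (\prod_(i < n) P (Y i @^-1` A i))%E.

Definition brownian_motion B : Prop :=
  [/\ forall t, 0 <= t -> measurable_fun setT (B t),
      forall w, B 0 w = 0,
      forall w, {within `[0, +oo[, continuous (B ^~ w)},
      forall s t, 0 <= s -> s < t -> forall A : set R, measurable A ->
        P ((B t \- B s) @^-1` A) = normal_prob 0 (Num.sqrt (t - s)) A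
    & forall n (t : nat -> R), 0 <= t 0 -> nondecreasing_seq t ->
        independent_rvs (fun i : 'I_n => B (t i.+1) \- B (t i))].

(* The sigma-algebras generated by X and by (B t)_(t >= 0) are independent. *)
Definition independent_of_process X B : Prop :=
  forall E F : set Omega,
    preimage_set_system setT X measurable E ->
    <<s \bigcup_(t in [set t : R | 0 <= t])
          preimage_set_system setT (B t) measurable >> F ->
    P (E `&` F) = (P E * P F)%E.

Definition hitting_time X B l (w : Omega) : \bar R :=
  ereal_inf [set t%:E | t in [set t : R | 0 <= t /\ X w + B t w - l t <= 0]].

Variable alpha : R.

(* For t < 0 the event is empty, so Gamma X B l t = 0, as required for the
   extension of a path with value 0 at 0-. *)
Definition Gamma X B l : R -> R :=
  fun t => alpha * fine (P [set w | (hitting_time X B l w <= t%:E)%E]).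

Definition MV_solution X B l : Prop :=
  M_space l /\ forall t, 0 <= t -> l t = Gamma X B l t.

Definition minimal_MV_solution X B l : Prop :=
  M_space l /\ M1_cvg \oo (fun n => iter n (Gamma X B) (cst 0)) l.

End McKean_Vlasov.

(* Main.v *)
Require Import Defs.
From HB Require Import structures.
From mathcomp Require Import all_boot all_order all_algebra.
From mathcomp Require Import all_classical all_reals all_analysis.
From mathcomp Require Import measurable_realfun ring lra.
Import Order.TTheory GRing.Theory Num.Theory.
Import numFieldNormedType.Exports.

(* Write [X^l = X + B - l].  Two facts drive the proof.  First, in the rotated
   coordinate [t + f t] the completed graph of a non-decreasing path is the
   graph of a 1-Lipschitz function, so M1 convergence of such paths is
   convergence of Levy type: values are only compared at distinct times [s < t].
   Second, for [t > 0] the path [X^l] almost surely does not touch level 0 on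
   [[0, t]] without crossing it: on [[a, t]] with [a > 0] its minimum is the sum
   of the Gaussian [B a] and an independent variable, hence has no atom, and at
   time 0 Brownian motion takes negative values immediately.  Crossing is an
   open condition, so [Gamma] is lower semicontinuous along increasing [l] and
   decreasing shifts; this makes the limit of the iterates a fixed point and
   transports every iterate for the shift [x] below the limit of [Lam y] as
   [y] decreases to [x].  As [x] increases to 0 the hitting events decrease, and
   a compactness argument on first hitting times shows that they decrease to
   the hitting event of the limit path, with no exceptional set. *)

Set Implicit Arguments.
Unset Strict Implicit.

Local Open Scope classical_set_scope.
Local Open Scope ring_scope.

(** * Non-decreasing paths and M1 convergence *)

Section M_paths.
Context {R : realType}.
Implicit Types (f g l : R -> R) (s t u e : R).

Lemma M_ge0 {l} : M_space l -> forall t, 0 <= l t.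
Proof.
move=> [_ nd l0] t; have [/l0->//|t0] := ltP t 0.
by rewrite -(l0 (-1)) ?nd//; lra.
Qed.

Lemma M_right {l} : M_space l -> forall t e, 0 < e ->
  exists2 u, t < u & l u < l t + e.
Proof.
move=> [cl _ _] t e e0; have [/cvgr_dist_lt/(_ _ e0) lt_e _] := cl t.
near t^'+ => u; exists u; first by near: u; exact: nbhs_right_gt.
have : `|l t - l u| < e by near: u.
by rewrite ltr_norml => /andP[+ _]; lra.
Unshelve. all: by end_near. Qed.

(** Monotonicity makes one point [u] to the right enough for right-continuity, and gives the left
    limits for free. *)
Lemma M_spaceI l : {homo l : s t / s <= t} -> (forall t, t < 0 -> l t = 0) ->
  (forall t e, 0 < e -> exists2 u, t < u & l u <= l t + e) -> M_space l.
Proof.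
move=> nd l0 lr; split => // t; split.
- apply/cvgrPdist_le => e e0; have [u tu lu] := lr t e e0.
  near=> s; have ts : t < s by near: s; exact: nbhs_right_gt.
  have su : s < u by near: s; exact: nbhs_right_lt.
  have := nd _ _ (ltW ts); have := nd _ _ (ltW su).
  by rewrite ler_norml; lra.
- apply: nondecreasing_at_left_is_cvgr.
    by near=> s => x y _ _; exact: nd.
  by near=> s; exists (l t) => _ [x /= + <-]; rewrite in_itv/= => /andP[_ /ltW/nd].
Unshelve. all: by end_near. Qed.

Lemma M_cst0 : M_space (cst 0 : R -> R).
Proof. by apply: M_spaceI => // t e e0; exists (t + 1); rewrite ?ltrDl//= add0r ltW. Qed.

Lemma left_value_le {l} a t : M_space l -> left_value a l t <= l t.
Proof.
move=> Ml; rewrite /left_value; case: eqP => [->//|_].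
apply: limr_le; first by have [/(_ t)[]] := Ml.
near=> s; have [_ nd _] := Ml; apply: nd; apply: ltW; near: s; exact: nbhs_left_lt.
Unshelve. all: by end_near. Qed.

Lemma le_left_value {l} a s t : M_space l -> s < t -> l s <= left_value a l t.
Proof.
move=> Ml st; have [_ nd _] := Ml.
rewrite /left_value; case: eqP => [<-|_]; first exact/nd/ltW.
apply: limr_ge; first by have [/(_ t)[]] := Ml.
near=> u; apply: nd; apply: ltW; near: u; exact: nbhs_left_gt.
Unshelve. all: by end_near. Qed.

(** At [t = a] the left value is by convention [l a], which earlier times do not control; the side
    condition restricts this case to [a < 0], where [l a] is 0. *)
Lemma left_value_ub {l} a t c : M_space l -> (t = a -> a < 0) ->
  (forall s, s < t -> l s <= c) -> left_value a l t <= c.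
Proof.
move=> Ml ta H; have [_ nd l0] := Ml.
rewrite /left_value; case: eqP => [/ta a0|_].
  rewrite (l0 _ a0); have [t0|t0] := leP t 0.
    by rewrite -(l0 (t - 1)) ?H//; lra.
  by rewrite -(l0 (-1)) ?H//; lra.
apply: limr_le; first by have [/(_ t)[]] := Ml.
near=> s; apply: H; near: s; exact: nbhs_left_lt.
Unshelve. all: by end_near. Qed.

End M_paths.

(* In the coordinate [s = t + y], which increases along the completed graph of
   a non-decreasing path, the graph is [(r s, s - r s)] with [r] the
   generalized inverse below; both components are non-decreasing and
   1-Lipschitz. *)
Definition graph_time {R : realType} (f : R -> R) (s : R) : R :=
  inf [set t | s <= t + f t].

Section graph_time.
Context {R : realType}.
Variable f : R -> R.
Hypothesis Mf : M_space f.
Let r := graph_time f.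

Let has_inf_r s : has_inf [set t | s <= t + f t].
Proof.
split; first by exists s; rewrite /= lerDl M_ge0.
(* Below [Num.min s 0] the path vanishes, so [t + f t = t < s]. *)
exists (Num.min s 0) => t /= st; rewrite leNgt; apply/negP.
have [_ _ f0] := Mf.
by rewrite lt_min => /andP[ts /f0 ft]; move: st; rewrite ft; lra.
Qed.

Lemma graph_time_le s t : s <= t + f t -> r s <= t.
Proof. by move=> st; apply: ge_inf => //; have [] := has_inf_r s. Qed.

Lemma lt_graph_time s t : t < r s -> t + f t < s.
Proof. by apply: contraTT; rewrite -!leNgt; exact: graph_time_le. Qed.

(** Right-continuity of [f] makes the infimum a minimum. *)
Lemma le_graph_time s : s <= r s + f (r s).
Proof.
have [_ nd _] := Mf.
apply/ler_addgt0Pr => e e0; have e2 : 0 < e / 2 by lra.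
have [u ru fu] := M_right Mf (r s) e2.
have [] := @inf_adherent _ _ (Num.min (u - r s) (e / 2)) _ (has_inf_r s).
  by rewrite lt_min e2 subr_gt0 ru.
move=> t /= st; rewrite -/(graph_time f s) -/(r s) -ltrBlDl lt_min !ltrBlDr.
rewrite subrK => /andP[tu te].
by have := nd _ _ (ltW tu); lra.
Qed.

(** Since [f] is non-decreasing, [t + f t] grows at least as fast as [t], so its inverse grows at
    most as fast as [s]. *)
Lemma graph_time_mono s s' : s <= s' -> r s <= r s' /\ r s' - r s <= s' - s.
Proof.
move=> ss'; split; first by apply: graph_time_le; exact: le_trans (le_graph_time s').
rewrite lerBlDr addrC; apply: graph_time_le.
have [_ nd _] := Mf; have rr : r s <= r s + (s' - s) by lra.
by have := nd _ _ rr; have := le_graph_time s; lra.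
Qed.

Lemma graph_time_lipschitz s s' : `|r s - r s'| <= `|s - s'|.
Proof.
wlog ss' : s s' / s <= s' => [H|].
  by have [/H//|/ltW/H] := leP s s'; rewrite distrC (distrC s).
have [] := graph_time_mono ss'; rewrite distrC (distrC s) => ? ?.
by rewrite !ger0_norm ?subr_ge0.
Qed.

Lemma graph_time_left_value a s : (r s = a -> a < 0) ->
  left_value a f (r s) <= s - r s.
Proof.
move=> a0; apply: left_value_ub => // t tr.
apply/ler_addgt0Pr => e e0.
pose t' := Num.max t (r s - e / 2).
have t'r : t' < r s by rewrite gt_max tr/=; lra.
have tt' : t <= t' by rewrite le_max lexx.
have et' : r s - e / 2 <= t' by rewrite le_max lexx orbT.
have [_ nd _] := Mf; have := nd _ _ tt'; have := lt_graph_time t'r; lra.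
Qed.

(** Before [t] the path stays below its left value at [t], so [t + y] cannot be reached earlier: the
    whole vertical segment over [t] is sent back to [t]. *)
Lemma graph_time_eq a t y : left_value a f t <= y -> y <= f t -> r (t + y) = t.
Proof.
move=> ly yf; apply/eqP; rewrite eq_le graph_time_le/= ?lerD2l//.
rewrite leNgt; apply/negP => rt.
have := le_left_value a Mf rt; have := le_graph_time (t + y); rewrite -/r.
lra.
Qed.

End graph_time.

(** * Parametric representations in the rotated coordinate *)

Section parametric.
Context {R : realType}.
Implicit Types (f g : R -> R) (T s : R).

(** The rotated coordinate [u] runs affinely from [-1], its value at time [-1] where the path is 0,
    to [T + f T]. *)
Definition graph_param f T (s : R) : R * R :=
  let u := -1 + s * (T + f T + 1) in (graph_time f u, u - graph_time f u).

Lemma graph_paramP f T : M_space f -> -1 < T ->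
  parametric_representation (-1) T f (graph_param f T).
Proof.
move=> Mf T1; have [_ nd f0] := Mf.
have fN1 : f (-1) = 0 by apply: f0; lra.
have fT0 := M_ge0 Mf T.
have D0 : 0 < T + f T + 1 by lra.
pose u s := -1 + s * (T + f T + 1).
have lv1 : left_value (-1) f (-1) = 0 by rewrite /left_value eqxx.
have ru0 : graph_time f (-1) = -1.
  by rewrite -{1}(addr0 (-1)) (@graph_time_eq _ _ Mf (-1)) ?lv1 ?fN1.
have ruT : graph_time f (T + f T) = T.
  by rewrite (@graph_time_eq _ _ Mf (-1))// left_value_le.
have u01 s : 0 <= s -> s <= 1 -> -1 <= u s <= T + f T.
  move=> s0 s1; rewrite /u; have : 0 <= s * (T + f T + 1) by rewrite mulr_ge0// ltW.
  have : 0 <= (1 - s) * (T + f T + 1) by rewrite mulr_ge0 ?subr_ge0// ltW.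
  lra.
split.
- apply: continuous_subspaceT => s.
  have cu : u x @[x --> s] --> u s.
    apply: cvgD; first exact: cvg_cst.
    by apply: cvgM; [exact: cvg_id|exact: cvg_cst].
  have cr : graph_time f (u x) @[x --> s] --> graph_time f (u s).
    apply/cvgrPdist_lt => e e0.
    move/cvgr_dist_lt : (cu) => /(_ e e0); apply: filterS => x.
    by apply: le_lt_trans; exact: graph_time_lipschitz.
  exact: (cvg_pair cr (cvgB cu cr)).
- apply/seteqP; split => [_ [s /= s01 <-]|[t y] /=].
    move: s01; rewrite in_itv/= => /andP[s0 s1].
    have /andP[ul uT] := u01 s s0 s1.
    rewrite /completed_graph/= -/(u s).
    have [r1 _] := graph_time_mono Mf ul; have [r2 _] := graph_time_mono Mf uT.
    rewrite ru0 in r1; rewrite ruT in r2; split; first by rewrite r1 r2.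
    set t := graph_time f (u s) in r1 r2 *.
    have ly : left_value (-1) f t <= u s - t by apply: graph_time_left_value.
    have yf : u s - t <= f t by rewrite lerBlDl; exact: le_graph_time.
    have [lf|] := ltP (left_value (-1) f t) (f t).
      have lf0 : 0 < f t - left_value (-1) f t by rewrite subr_gt0.
      (* This is [y = c * left_value + (1 - c) * f t] solved for [c]; without a jump any [c] works,
         and 0 is taken below. *)
      exists ((f t - (u s - t)) / (f t - left_value (-1) f t)).
        by rewrite divr_ge0 ?ler_pdivrMr ?(ltW lf0)//=; lra.
      have -> : f t - (u s - t) = f t - u s + t by lra.
      have : f t - left_value (-1) f t != 0 by rewrite gt_eqF.
      by move: (left_value _ _ _) => L nz; field.
    by move=> fl; exists 0; lra.
  move=> [/= /andP[t1 tT] [c /andP[c0 c1] yE]].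
  have ly : left_value (-1) f t <= y.
    have := left_value_le (-1) t Mf; rewrite yE -subr_ge0 => H.
    rewrite -subr_ge0 [leRHS](_ : _ = (1 - c) * (f t - left_value (-1) f t)); last by lra.
    by rewrite mulr_ge0//; lra.
  have yf : y <= f t.
    have := left_value_le (-1) t Mf; rewrite yE -subr_ge0 => H.
    rewrite -subr_ge0 [leRHS](_ : _ = c * (f t - left_value (-1) f t)); last by lra.
    by rewrite mulr_ge0//; lra.
  have uE : u ((t + y + 1) / (T + f T + 1)) = t + y by rewrite /u divfK ?gt_eqF//; lra.
  have y0 : 0 <= y.
    move: t1; rewrite le_eqVlt => /predU1P[t1|/(le_left_value (-1) Mf)].
      by move: ly; rewrite -t1 lv1.
    by rewrite fN1 => /le_trans; exact.
  exists ((t + y + 1) / (T + f T + 1)).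
    rewrite /= in_itv/= divr_ge0 ?ler_pdivrMr ?(ltW D0)//=; last lra.
    by have := nd _ _ tT; lra.
  by rewrite /graph_param -/(u _) uE (graph_time_eq Mf ly yf) addrC addKr.
- move=> s s' s0 ss' s1.
  rewrite /graph_le/= -/(u s) -/(u s').
  have uu : u s <= u s' by rewrite /u lerD2l ler_wpM2r// ltW.
  have [r1 r2] := graph_time_mono Mf uu.
  move: r1; rewrite le_eqVlt => /predU1P[r1|]; [right|by left].
  split => //; rewrite -r1.
  have ly : left_value (-1) f (graph_time f (u s)) <= u s - graph_time f (u s).
    exact: graph_time_left_value.
  rewrite !ler0_norm ?subr_le0 ?opprB//; lra.
Qed.

End parametric.

(** * Levy-type closeness and M1 distance *)

Section M1.
Context {R : realType}.
Implicit Types (f g : R -> R) (T e s t : R).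

(** One [e] comes from comparing the two generalized inverses at the same rotated coordinate, the
    other from the gap between the end points, which moves that coordinate by at most [e]. *)
Lemma graph_time_close f g T e s : M_space f -> M_space g ->
  -1 < T -> 0 < e -> `|f T - g T| <= e ->
  (forall t, t <= T -> g t <= f (t + e) + e) -> 0 <= s <= 1 ->
  (graph_param f T s).1 <= (graph_param g T s).1 + 2 * e.
Proof.
move=> Mf Mg T1 e0 fgT gf /andP[s0 s1]; rewrite /graph_param/=.
set u := _ + s * (T + f T + 1); set v := _ + s * (T + g T + 1).
have uv : `|u - v| <= e.
  rewrite (_ : u - v = s * (f T - g T)); last by rewrite /u /v; lra.
  rewrite normrM (ger0_norm s0) (le_trans _ fgT)//.
  by rewrite -[leRHS]mul1r ler_wpM2r.
have gT0 := M_ge0 Mg T.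
have vT : v <= T + g T.
  have : 0 <= (1 - s) * (T + g T + 1) by rewrite mulr_ge0//; lra.
  by rewrite /v; lra.
have rvT : graph_time g v <= T by exact: graph_time_le.
have fv : graph_time f v <= graph_time g v + e.
  apply: graph_time_le => //; have := le_graph_time Mg v; have := gf _ rvT; lra.
have := graph_time_lipschitz Mf u v.
rewrite ler_norml => /andP[_]; lra.
Qed.

(** The time coordinates of the two canonical representations differ by at most [2 * e]; the values
    are the rotated coordinates, which differ by at most [e], minus the times. *)
Lemma M1_dist_le f g T e : M_space f -> M_space g ->
  -1 < T -> 0 < e -> `|f T - g T| <= e ->
  (forall t, t <= T -> f t <= g (t + e) + e) ->
  (forall t, t <= T -> g t <= f (t + e) + e) ->
  (M1_dist (-1) T f g <= (3 * e)%:E)%E.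
Proof.
move=> Mf Mg T1 e0 fgT fg gf.
have gfT : `|g T - f T| <= e by rewrite distrC.
apply: (@le_trans _ _ (ereal_sup
    [set `|graph_param f T s - graph_param g T s|%:E | s in `[0, 1]])).
  by apply: ereal_inf_lbound => /=; do 2 eexists; split; [exact: graph_paramP..|].
apply: ge_ereal_sup => _ [s /= + <-]; rewrite in_itv/= => s01.
have := graph_time_close Mf Mg T1 e0 fgT gf s01.
have := graph_time_close Mg Mf T1 e0 gfT fg s01.
rewrite lee_fin prod_normE/= ge_max !ler_norml.
set u := _ + s * (T + f T + 1); set v := _ + s * (T + g T + 1).
have : `|u - v| <= e.
  rewrite (_ : u - v = s * (f T - g T)); last by rewrite /u /v; lra.
  move/andP : s01 => [s0 s1]; rewrite normrM (ger0_norm s0) (le_trans _ fgT)//.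
  by rewrite -[leRHS]mul1r ler_wpM2r.
rewrite ler_norml => /andP[] *; apply/andP; split; apply/andP; split; lra.
Qed.

Lemma M1_dist_ge0 a b f g : (0 <= M1_dist a b f g)%E.
Proof.
apply: le_ereal_inf_tmp => _ [h [k [_ _ ->]]].
apply: (@le_trans _ _ `|h 0 - k 0|%:E); first by rewrite lee_fin.
by apply: ereal_sup_ubound; exists 0 => //=; rewrite in_itv/= lexx ler01.
Qed.

Lemma ereal_cvg0 (I : Type) (F : set_system I) {FF : Filter F} (f : I -> \bar R) :
  (forall i, (0 <= f i)%E) ->
  (forall e, 0 < e -> \forall i \near F, (f i <= e%:E)%E) <->
  f i @[i --> F] --> 0%E.
Proof.
move=> f0; split => [fe|/fine_cvgP[ffin /cvgr_dist_lt f_0] e e0].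
  apply/fine_cvgP; split.
    have := fe _ ltr01; apply: filterS => i fi.
    by rewrite ge0_fin_numE// (le_lt_trans fi)// ltry.
  apply/cvgrPdist_le => e /fe; apply: filterS => i fi.
  have : f i \is a fin_num by rewrite ge0_fin_numE// (le_lt_trans fi)// ltry.
  move=> /fineK fiE; rewrite sub0r normrN ger0_norm ?fine_ge0//.
  by rewrite -lee_fin fiE.
near=> i; have fi : f i \is a fin_num by near: i.
rewrite -(fineK fi) lee_fin.
have : `|0 - fine (f i)| < e by near: i; exact: f_0.
by rewrite sub0r normrN ltr_norml => /andP[_ /ltW].
Unshelve. all: by end_near. Qed.

(** Monotonicity reduces the uniform bound to finitely many points of a grid of mesh [e / 2]. *)
Lemma near_shift_le (I : Type) (F : set_system I) {FF : Filter F}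
    (a b : I -> R -> R) T e :
  (forall i, M_space (a i)) -> (forall i, M_space (b i)) -> 0 < e ->
  (forall s t e', s < t -> 0 < e' -> \forall i \near F, a i s <= b i t + e') ->
  \forall i \near F, forall t, t <= T -> a i t <= b i (t + e) + e.
Proof.
move=> Ma Mb e0 ab; pose N := (Num.truncn (T / (e / 2))).+1.
have : \forall i \near F, forall j : 'I_N,
    a i (j.+1%:R * (e / 2)) <= b i (j.+2%:R * (e / 2)) + e.
  apply: filter_forall => j; apply: ab => //.
  by rewrite ltr_pM2r ?ltr_nat//; lra.
apply: filterS => i abi t tT.
have [t0|t0] := ltP t 0.
  by have [_ _ ->] := Ma i; rewrite // addr_ge0 ?(ltW e0) ?M_ge0.
have e2 : 0 < e / 2 by lra.
have te0 : 0 <= t / (e / 2) by rewrite divr_ge0// ltW.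
have jN : (Num.truncn (t / (e / 2)) < N)%N.
  by rewrite ltnS Num.Theory.le_truncn// ler_wpM2r// invr_ge0 ltW.
(* With [j] the integer part of [t / (e / 2)], [t] lies below grid point [j.+1], and grid point
   [j.+2] lies below [t + e]. *)
have /andP[] := Num.Theory.truncn_itv te0.
rewrite ler_pdivlMr// ltr_pdivrMr//.
move: (abi (Ordinal jN)) => /= {abi}.
move: (Num.truncn _) => j abi jt tj.
have [_ nda _] := Ma i; have [_ ndb _] := Mb i.
have := nda _ _ (ltW tj).
have /ndb : j.+2%:R * (e / 2) <= t + e.
  by rewrite -addn2 natrD mulrDl; lra.
lra.
Qed.

(** A monotone function has countably many discontinuities, which form a null set and cannot fill an
    open interval. *)
Lemma M_cvg_left_in g a b : M_space g -> a < b ->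
  exists T, [/\ a < T, T < b & (g s @[s --> T^'-] --> g T)].
Proof.
move=> Mg ab; have [cg nd _] := Mg.
have : countable [set x | (x \in `]a, b[) /\ discontinuity g x].
  by apply: discontinuity_countable => x y _ _; exact: nd.
move=> /countable_lebesgue_measure0.
set D := [set x | _] => D0.
have [T /= [Tab nT]] : exists T, `]a, b[%classic T /\ ~ D T.
  apply: contrapT => H; have abD : `]a, b[%classic `<=` D.
    by move=> x xab; apply: contrapT => nDx; apply: H; exists x.
  have : (lebesgue_measure `]a, b[%classic <= lebesgue_measure D)%E.
    apply: le_outer_measure => //.
  by rewrite D0 lebesgue_measure_itv/= lte_fin ab -EFinB lee_fin; lra.
exists T; move: (Tab); rewrite /= in_itv/= => /andP[-> ->]; split => //.
have [gr gl] := cg T.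
have : ~ discontinuity g T by move=> dT; apply: nT; split.
move=> dT; have [E|/eqP E] := pselect (lim (g x @[x --> T^'-]) = lim (g x @[x --> T^'+])).
  by rewrite -(cvg_lim _ gr)// -E.
by exfalso; apply: dT; split => //; exact: cvgP gr.
Qed.

(* Weak (Levy) closeness only compares values at distinct times, so it needs
   no continuity points except for the right end points. *)
Lemma M1_cvg_of_weak (I : Type) (F : set_system I) {FF : ProperFilter F}
    (f : I -> R -> R) g :
  (forall i, M_space (f i)) -> M_space g ->
  (forall s t e, s < t -> 0 < e -> \forall i \near F, f i s <= g t + e) ->
  (forall s t e, s < t -> 0 < e -> \forall i \near F, g s <= f i t + e) ->
  M1_cvg F f g.
Proof.
move=> Mf Mg fg gf.
have [_ nd _] := Mg.
have /boolp.choice[T HT] (n : nat) : exists T,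
    [/\ n%:R < T, T < n.+1%:R & (g s @[s --> T^'-] --> g T)].
  by apply: M_cvg_left_in => //; rewrite ltr_nat.
exists T; split.
- apply/nondecreasing_seqP => n; have [_ T1 _] := HT n; have [T2 _ _] := HT n.+1.
  exact: ltW (lt_trans T1 T2).
- apply/cvgryPge => A; near=> n; have [Tn _ _] := HT n.
  apply: le_trans (ltW Tn); near: n; exact: nbhs_infty_ger.
move=> n; have [Tn _ cT] := HT n.
have T1 : -1 < T n by apply: lt_trans Tn; rewrite (@lt_le_trans _ _ 0)// ltrN10.
split => //.
apply/ereal_cvg0 => [i|e e0]; first exact: M1_dist_ge0.
pose d := e / 3; have d0 : 0 < d by rewrite divr_gt0.
have fgs := near_shift_le (T n) Mf (fun=> Mg) d0 fg.
have gfs := near_shift_le (T n) (fun=> Mg) Mf d0 gf.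
(* At the end point [T n] the values themselves must be close; continuity of [g] there provides [u]
   on the right and [v] on the left that sandwich [f i (T n)]. *)
have [u Tu gu] := M_right Mg (T n) (e := d / 2) ltac:(lra).
have [v vT gv] : exists2 v, v < T n & g (T n) - d / 2 < g v.
  near (T n)^'- => v; exists v; first by near: v; exact: nbhs_left_lt.
  have : `|g (T n) - g v| < d / 2.
    by near: v; move/cvgr_dist_lt : cT; apply; lra.
  by rewrite ltr_norml => /andP[_]; lra.
have fu := fg _ _ (d / 2) Tu ltac:(lra).
have fv := gf _ _ (d / 2) vT ltac:(lra).
near=> i.
have fi1 : forall t, t <= T n -> f i t <= g (t + d) + d by near: i; exact: fgs.
have fi2 : forall t, t <= T n -> g t <= f i (t + d) + d by near: i; exact: gfs.
have fiu : f i (T n) <= g u + d / 2 by near: i.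
have fiv : g v <= f i (T n) + d / 2 by near: i.
rewrite (_ : e = 3 * d); last by rewrite /d; lra.
by apply: M1_dist_le => //; rewrite ler_norml; lra.
Unshelve. all: by end_near. Qed.

(** A nearly optimal pair of representations matches [(t, f i t)] with a point of the completed
    graph of [g] less than [e] away in both coordinates; monotonicity of [g] then bounds its
    value. *)
Lemma M1_cvg_weak (I : Type) (F : set_system I) {FF : ProperFilter F}
    (f : I -> R -> R) g t e : M_space g -> M1_cvg F f g -> -1 <= t -> 0 < e ->
  \forall i \near F, g (t - e) - e <= f i t <= g (t + e) + e.
Proof.
move=> Mg [T [_ Too HT]] t1 e0; have [_ nd _] := Mg.
have [N tN] : exists N, t <= T N.
  near \oo => N; exists N; near: N; exact: (cvgry_ge Too).
have [TN /ereal_cvg0 dT] := HT N.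
have := dT (fun=> M1_dist_ge0 _ _ _ _) _ (divr_gt0 e0 (ltr0Sn _ 1)).
apply: filterS => i fi.
have /ereal_inf_lt[_ [h [k [[_ hf _] [_ kg _] ->]]] supe] :
    (M1_dist (-1) (T N) (f i) g < e%:E)%E.
  by apply: le_lt_trans fi _; rewrite lte_fin gtr_pMr// invf_lt1// ltr1n.
have [s s01 hs] : (h @` `[0, 1]) (t, f i t).
  rewrite hf /completed_graph/= t1 tN; split => //.
  by exists 0; rewrite ?lexx ?ler01// mul0r add0r subr0 mul1r.
have /= [/andP[k1 kT] [c /andP[c0 c1] k2]] : completed_graph (-1) (T N) g (k s).
  by rewrite -kg; exists s.
have : `|h s - k s| < e.
  rewrite -lte_fin; apply: le_lt_trans supe.
  by apply: ereal_sup_ubound; exists s.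
rewrite prod_normE/= hs/= gt_max => /andP[].
rewrite !ltr_norml => /andP[d1 d2] /andP[d3 d4].
have tk : t - e < (k s).1 by lra.
have kt : (k s).1 <= t + e by lra.
have := le_left_value (-1) Mg tk; have := left_value_le (-1) (k s).1 Mg.
have := nd _ _ kt; move: k2 d3 d4.
move: (left_value _ _ _) => L; move: (g (k s).1) (g (t - e)) (g (t + e)) (f i t).
move=> G g1 g2 y -> d3 d4 Gg2 LG g1L.
have := mulr_ge0 c0 (_ : 0 <= G - L); rewrite subr_ge0 => /(_ LG).
have c1' : 0 <= 1 - c by lra.
have := mulr_ge0 c1' (_ : 0 <= G - L); rewrite subr_ge0 => /(_ LG).
lra.
Unshelve. all: by end_near. Qed.

(** The Levy-type bounds of [M1_cvg_weak] are tightened on the upper side by right-continuity of [g]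
    and monotonicity in [n]. *)
Lemma M1_cvg_nondecreasing (l : nat -> R -> R) g :
  (forall n, M_space (l n)) -> M_space g ->
  (forall n t, l n t <= l n.+1 t) -> M1_cvg \oo l g ->
  (forall n t, l n t <= g t) /\
  (forall s t e, s < t -> 0 < e -> exists n, g s <= l n t + e).
Proof.
move=> Ml Mg l_nd lg; have l_nd' t : nondecreasing_seq (l ^~ t).
  by apply/nondecreasing_seqP => n.
have [_ nd g0] := Mg.
split=> [n t|s t e st e0].
  have [t0|t0] := ltP t 0; first by have [_ _ ->] := Ml n; rewrite ?g0.
  apply/ler_addgt0Pr => e e0; have e2 : 0 < e / 2 by lra.
  have [u tu gu] := M_right Mg t e2.
  pose d := Num.min (u - t) (e / 2).
  have d0 : 0 < d by rewrite lt_min subr_gt0 tu.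
  have dm : d <= u - t /\ d <= e / 2 by rewrite !ge_min !lexx orbT.
  near \oo => m.
  have /andP[_ lm] : g (t - d) - d <= l m t <= g (t + d) + d.
    by near: m; apply: M1_cvg_weak => //; lra.
  have : l n t <= l m t by apply: l_nd'; near: m; exact: nbhs_infty_ge.
  have : g (t + d) <= g u by apply: nd; lra.
  lra.
have [t0|t0] := ltP t 0.
  by exists 0%N; rewrite g0; [have := M_ge0 (Ml 0%N) t; lra|lra].
pose d := Num.min (t - s) e.
have d0 : 0 < d by rewrite lt_min subr_gt0 st.
have dm : d <= t - s /\ d <= e by rewrite !ge_min !lexx orbT.
near \oo => m; exists m.
have /andP[lm _] : g (t - d) - d <= l m t <= g (t + d) + d.
  by near: m; apply: M1_cvg_weak => //; lra.
have : g s <= g (t - d) by apply: nd; lra.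
lra.
Unshelve. all: by end_near. Qed.

End M1.

(** * Hitting events *)

Section first_hit.
Context {R : realType}.
Implicit Types (b l : R -> R) (s t x e : R).

Lemma within_continuous_dist b s e : {within `[0, +oo[, continuous b} ->
  0 <= s -> 0 < e ->
  exists2 d, 0 < d & forall u, 0 <= u -> `|u - s| < d -> `|b u - b s| < e.
Proof.
move=> /continuous_within_itvcyP [cb cb0] s0 e0.
move: s0; rewrite le_eqVlt => /predU1P[<-|s0].
  move/cvgr_dist_lt : cb0 => /(_ _ e0)[d /= d0 dP]; exists d => // u.
  rewrite le_eqVlt => /predU1P[<-|u0]; first by rewrite !subrr !normr0.
  by rewrite distrC => /dP/(_ u0); rewrite distrC.
have /cb/cvgr_dist_lt/(_ _ e0)[d /= d0 dP] : s \in `]0, +oo[ by rewrite in_itv/= s0.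
by exists d => // u _; rewrite distrC => /dP; rewrite distrC.
Qed.

(** Continuity of [b] with monotonicity and right-continuity of [l] would keep a positive value at
    the infimum positive shortly afterwards, so the infimum is itself a hitting time. *)
Lemma first_hit b l x s : {within `[0, +oo[, continuous b} -> M_space l ->
  0 <= s -> x + b s - l s <= 0 ->
  exists i, [/\ 0 <= i, x + b i - l i <= 0 &
    forall u, 0 <= u -> x + b u - l u <= 0 -> i <= u].
Proof.
move=> cb Ml s0 sE; pose E := [set u | 0 <= u /\ x + b u - l u <= 0].
have [_ nd _] := Ml.
have lbE : lbound E 0 by move=> u [].
have hE : has_inf E by split; [exists s|exists 0].
have leE u : E u -> inf E <= u by move=> Eu; apply: ge_inf => //; exists 0.
have i0 : 0 <= inf E by apply: lb_le_inf => //; exists s.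
exists (inf E); split => //; last by move=> u u0 uE; apply: leE.
rewrite leNgt; apply/negP => Zi; pose e := (x + b (inf E) - l (inf E)) / 2.
have e0 : 0 < e by rewrite /e; lra.
have [d d0 db] := within_continuous_dist cb i0 e0.
have [v iv lv] := M_right Ml (inf E) e0.
have m0 : 0 < Num.min d (v - inf E) by rewrite lt_min d0 subr_gt0.
have [u Eu] := inf_adherent m0 hE.
rewrite -ltrBlDl lt_min => /andP[ud uv].
have iu := leE _ Eu; have [u0 uE] := Eu.
have := db _ u0; rewrite ger0_norm ?subr_ge0// => /(_ ud).
rewrite ltr_norml => /andP[bu _].
have : l u <= l v by apply: nd; lra.
by move: bu lv; rewrite /e; lra.
Qed.

(* The first hitting times increase with [k], and their supremum is a hitting
   time of all the paths. *)
Lemma nested_hits b (l : nat -> R -> R) (x : nat -> R) t :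
  {within `[0, +oo[, continuous b} -> (forall k, M_space (l k)) ->
  (forall k m s, (m <= k)%N -> l k s <= l m s) ->
  (forall k m, (m <= k)%N -> x m <= x k) ->
  (forall k, exists2 s, 0 <= s <= t & x k + b s - l k s <= 0) ->
  exists2 s, 0 <= s <= t & forall k, x k + b s - l k s <= 0.
Proof.
move=> cb Ml lkm xmk hit.
have /boolp.choice[h hP] k : exists i, [/\ 0 <= i, x k + b i - l k i <= 0 &
    forall u, 0 <= u -> x k + b u - l k u <= 0 -> i <= u].
  by have [s /andP[s0 _] sE] := hit k; exact: first_hit sE.
have ht k : h k <= t.
  have [s /andP[s0 st] sE] := hit k; have [_ _ hk] := hP k.
  exact: le_trans (hk s s0 sE) st.
have h_nd m k : (m <= k)%N -> h m <= h k.
  move=> mk; have [_ _ hm] := hP m; have [hk0 hkE _] := hP k; apply: hm => //.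
  by have := lkm _ _ (h k) mk; have := xmk _ _ mk; lra.
have hsup : has_sup (range h).
  by split; [exists (h 0%N); exists 0%N|exists t => _ [k _ <-]].
have hS k : h k <= sup (range h) by apply: ub_le_sup; [case: hsup|exists k].
have S0 : 0 <= sup (range h) by have [h0 _ _] := hP 0%N; exact: le_trans (hS 0%N).
exists (sup (range h)).
  rewrite S0/=; apply: ge_sup => [|_ [k _ <-]//]; by case: hsup.
(* If path [m] were positive at the supremum, a first hit shortly before it, of an index at least
   [m], would contradict continuity of [b]; no left-continuity of [l m] is involved, as it can only
   be smaller earlier. *)
move=> m; rewrite leNgt; apply/negP => Zm.
have [d d0 db] := within_continuous_dist cb S0 Zm.
have [_ [k _ <-] kS] := sup_adherent d0 hsup.
have := hS (maxn k m); have := h_nd k (maxn k m) (leq_maxl _ _).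
have := leq_maxr k m; move: (maxn k m) => n mn kn nS.
have [n0 nE _] := hP n; have := db _ n0.
rewrite ler0_norm ?subr_le0// ltr_norml.
have : sup (range h) - h n < d by lra.
rewrite opprB => -> /(_ isT)/andP[bn _].
have [_ nd _] := Ml m.
have := nd _ _ nS; have := lkm _ _ (h n) mn; have := xmk _ _ mn; lra.
Qed.

End first_hit.

(** * Continuity of probability along monotone sequences of events *)

Section prob_limits.
Context {R : realType} {d : measure_display} {Omega : measurableType d}.
Variable P : probability Omega R.
Implicit Types (A C : set Omega) (F : nat -> set Omega).

Lemma fine_prob_le A C : measurable A -> measurable C -> A `<=` C ->
  fine (P A) <= fine (P C).
Proof. by move=> mA mC AC; rewrite fine_le ?fin_num_measure ?le_measure ?inE. Qed.

Lemma fine_prob_bigcap F e : (forall k, measurable (F k)) ->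
  (forall k, F k.+1 `<=` F k) -> 0 < e ->
  exists k, fine (P (F k)) <= fine (P (\bigcap_k F k)) + e.
Proof.
move=> mF Fnd e0.
have mI : measurable (\bigcap_k F k) by exact: bigcapT_measurable.
have ndF : nonincreasing_seq F.
  by apply/nonincreasing_seqP => n; apply/subsetPset; exact: Fnd.
have P0 : (P (F 0%N) < +oo)%E by rewrite (le_lt_trans (probability_le1 _ _))// ltry.
have : (P \o F) k @[k --> \oo] --> P (\bigcap_k F k).
  exact: nonincreasing_cvg_mu P0 mF mI ndF.
rewrite -(fineK (fin_num_measure P _ mI)) => /fine_cvgP [_] /cvgr_dist_lt/(_ _ e0) PF.
near \oo => k; exists k.
have : `|fine (P (\bigcap_k F k)) - (fine \o (P \o F)) k| < e by near: k.
by rewrite /= ltr_norml => /andP[]; lra.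
Unshelve. all: by end_near. Qed.

Lemma fine_prob_bigcup F e : (forall k, measurable (F k)) ->
  (forall k, F k `<=` F k.+1) -> 0 < e ->
  exists k, fine (P (\bigcup_k F k)) <= fine (P (F k)) + e.
Proof.
move=> mF Fnd e0.
have mU : measurable (\bigcup_k F k) by exact: bigcupT_measurable.
have ndF : nondecreasing_seq F.
  by apply/nondecreasing_seqP => n; apply/subsetPset; exact: Fnd.
have : (P \o F) k @[k --> \oo] --> P (\bigcup_k F k).
  exact: nondecreasing_cvg_mu mF mU ndF.
rewrite -(fineK (fin_num_measure P _ mU)) => /fine_cvgP [_] /cvgr_dist_lt/(_ _ e0) PF.
near \oo => k; exists k.
have : `|fine (P (\bigcup_k F k)) - (fine \o (P \o F)) k| < e by near: k.
by rewrite /= ltr_norml => /andP[]; lra.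
Unshelve. all: by end_near. Qed.

End prob_limits.

Section hits.
Context {R : realType} {Omega : Type}.
Implicit Types (X Y : Omega -> R) (B : R -> Omega -> R) (l m : R -> R) (s t : R).

Definition hits X B l t : set Omega :=
  [set w | exists2 s, 0 <= s <= t & X w + B s w - l s <= 0].

Definition crosses X B l t : set Omega :=
  [set w | exists2 s, 0 <= s <= t & X w + B s w - l s < 0].

Lemma hits_le X Y B l m s t : (forall w, Y w <= X w) ->
  (forall u, l u <= m u) -> s <= t -> hits X B l s `<=` hits Y B m t.
Proof.
move=> YX lm st w [u /andP[u0 us] uE]; exists u; first by rewrite u0 (le_trans us).
by have := YX w; have := lm u; lra.
Qed.

End hits.

(** * Measurability of the events, and [Gamma] as a monotone map of [M_space] *)

Section Gamma.
Context {R : realType} {d : measure_display} {Omega : measurableType d}.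
Variables (P : probability Omega R) (B : R -> Omega -> R).
Hypothesis mB : forall t, 0 <= t -> measurable_fun setT (B t).
Hypothesis cB : forall w, {within `[0, +oo[, continuous (B ^~ w)}.
Arguments cB : clear implicits.
Implicit Types (X Y : Omega -> R) (l m : R -> R) (s t : R).

Lemma hitting_time_le X l t : M_space l ->
  [set w | (hitting_time X B l w <= t%:E)%E] = hits X B l t.
Proof.
move=> Ml; apply/seteqP; split=> [w /= ht|w [s /andP[s0 st] sE]]; last first.
  apply: (@le_trans _ _ s%:E); last by rewrite lee_fin.
  by apply: ereal_inf_lbound; exists s.
have near_hit e : 0 < e -> exists2 s, 0 <= s < t + e & X w + B s w - l s <= 0.
  move=> e0; have /ereal_inf_lt[_ [s [s0 sE] <-]] : (hitting_time X B l w < (t + e)%:E)%E.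
    by apply: le_lt_trans ht _; rewrite lte_fin ltrDl.
  by rewrite lte_fin => st; exists s; rewrite ?s0.
have [s /andP[s0 _] sE] := near_hit 1 ltr01.
have [i [i0 iE imin]] := first_hit (cB w) Ml s0 sE.
exists i => //; rewrite i0/=; apply/ler_addgt0Pr => e /near_hit[u /andP[u0 ut]].
by move=> /(imin _ u0) /le_trans; apply; exact: ltW.
Qed.

Lemma measurable_crosses X l t : measurable_fun setT X -> M_space l ->
  measurable (crosses X B l t).
Proof.
move=> mX Ml; have [_ nd _] := Ml.
pose Z s := [set w | 0 <= s <= t /\ X w + B s w - l s < 0].
have mZ s : measurable (Z s).
  rewrite /Z; have [/andP[s0 _]|_] := boolP (0 <= s <= t); last first.
    by rewrite (_ : [set _ | _] = set0)//; apply/seteqP; split => // w [].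
  rewrite (_ : [set _ | _] = (fun w => X w + B s w - l s) @^-1` `]-oo, 0[); last first.
    by apply/seteqP; split => w /=; rewrite in_itv/=; [case|].
  rewrite -[X in measurable X]setTI.
  apply: (_ : measurable_fun setT _) => //.
  by apply: measurable_funB => //; apply: measurable_funD => //; exact: mB.
(* A strictly negative value persists shortly to the right, as [B] is continuous and [l]
   non-decreasing, so rational times suffice; [t] is added because no room is left to its right. *)
rewrite (_ : crosses X B l t = Z t `|` \bigcup_(q : rat) Z (ratr q)); last first.
  apply/seteqP; split => w; last first.
    by move=> [[tt tE]|[q _ [qt qE]]]; [exists t|exists (ratr q)].
  move=> [s /andP[s0]]; rewrite le_eqVlt => /predU1P[ts|st] sE.
    by left; rewrite /Z -ts; split; rewrite // s0 lexx.
  right; pose e := (l s - X w - B s w).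
  have e0 : 0 < e by rewrite /e; lra.
  have [dl d0 db] := within_continuous_dist (cB w) s0 e0.
  have : s < Num.min t (s + dl) by rewrite lt_min st ltrDl.
  move=> /rat_in_itvoo[q]; rewrite in_itv/= lt_min => /and3P[sq qt qd].
  exists q => //; split; first by rewrite (le_trans s0 (ltW sq)) ltW.
  have := db _ (le_trans s0 (ltW sq)).
  rewrite ger0_norm ?subr_ge0 ?(ltW sq)// ltrBlDl => /(_ qd).
  rewrite ltr_norml => /andP[_]; have := nd _ _ (ltW sq); rewrite /e; lra.
by apply: measurableU => //; exact: bigcupT_measurable_rat.
Qed.

Lemma measurable_hits X l t : measurable_fun setT X -> M_space l ->
  measurable (hits X B l t).
Proof.
move=> mX Ml.
(* Crossing after every downward shift by [k.+1%:R^-1] yields a common hitting time, by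
   [nested_hits] with a constant path. *)
rewrite (_ : hits _ _ _ _ =
    \bigcap_(k : nat) crosses (fun w => X w - k.+1%:R^-1) B l t).
  apply: bigcapT_measurable => k; apply: measurable_crosses => //.
  exact: measurable_funB.
apply/seteqP; split => w.
  move=> [s st sE] k _; exists s => //.
  have : 0 < (k.+1%:R : R)^-1 by [].
  by move: (_^-1) => q; lra.
move=> hw.
have [||||s st sE] := @nested_hits R (B ^~ w) (fun=> l) (fun k => X w - k.+1%:R^-1) t (cB w).
- by [].
- by [].
- by move=> k m mk; rewrite lerD2l lerN2 lef_pV2 ?posrE// ler_nat.
- by move=> k; have [s st sE] := hw k I; exists s => //; exact: ltW.
exists s => //; apply/ler_addgt0Pr => e e0.
have [k ke] : exists k, k.+1%:R^-1 < e.
  near \oo => k; exists k; near: k; exact: near_infty_natSinv_lt (PosNum e0).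
by have /= := sE k; move: ke; move: (_^-1) => q; lra.
Unshelve. all: by end_near. Qed.

Lemma bigcap_hits X l t : M_space l ->
  \bigcap_(k : nat) hits X B l (t + k.+1%:R^-1) = hits X B l t.
Proof.
move=> Ml; apply/seteqP; split => w; last first.
  by move=> wt k _; move: wt; apply: hits_le; rewrite // lerDl.
move=> wk; have [s /andP[s0 _] sE] := wk 0%N I.
have [i [i0 iE imin]] := first_hit (cB w) Ml s0 sE.
exists i => //; rewrite i0/=; apply/ler_addgt0Pr => e e0.
have [k ke] : exists k, k.+1%:R^-1 < e.
  near \oo => k; exists k; near: k; exact: near_infty_natSinv_lt (PosNum e0).
have [u /andP[u0 ut] /(imin _ u0)iu] := wk k I.
by move: ke ut; move: (_^-1) => q; lra.
Unshelve. all: by end_near. Qed.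

Variable alpha : R.
Hypothesis alpha_gt0 : 0 < alpha.

Lemma GammaE X l t : M_space l ->
  Gamma P alpha X B l t = alpha * fine (P (hits X B l t)).
Proof. by move=> Ml; rewrite /Gamma hitting_time_le. Qed.

Lemma Gamma_le X Y l m s t : measurable_fun setT X -> measurable_fun setT Y ->
  M_space l -> M_space m ->
  (forall w, Y w <= X w) -> (forall u, l u <= m u) -> s <= t ->
  Gamma P alpha X B l s <= Gamma P alpha Y B m t.
Proof.
move=> mX mY Ml Mm YX lm st; rewrite !GammaE// ler_pM2l//.
by apply: fine_prob_le; [exact: measurable_hits..|exact: hits_le].
Qed.

(** Right-continuity is continuity from above of [P] along the events of [bigcap_hits]. *)
Lemma Gamma_M X l : measurable_fun setT X -> M_space l ->
  M_space (Gamma P alpha X B l).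
Proof.
move=> mX Ml; apply: M_spaceI => [s t st|t t0|t e e0].
- exact: Gamma_le.
- rewrite GammaE// (_ : hits _ _ _ _ = set0) ?measure0 ?mulr0//.
  by apply/seteqP; split => // w [s]; lra.
have [||k] := @fine_prob_bigcap _ _ _ P (fun k => hits X B l (t + k.+1%:R^-1))
  _ _ _ (divr_gt0 e0 alpha_gt0).
- by move=> k; exact: measurable_hits.
- by move=> k; apply: hits_le => //; rewrite lerD2l lef_pV2 ?posrE// ler_nat.
rewrite bigcap_hits// => le_k; exists (t + k.+1%:R^-1); first by rewrite ltrDl.
by rewrite !GammaE// -lerBlDl -mulrBr mulrC -ler_pdivlMr// lerBlDl.
Qed.

End Gamma.

(** * Touching without crossing has probability zero *)

Section normal_bounds.
Context {R : realType}.
Implicit Types (s a b : R).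

Lemma normal_peakE s : 0 < s -> normal_peak s * s = normal_peak (1 : R).
Proof.
move=> s0; rewrite /normal_peak expr1n -mulrnAr sqrtrM ?sqr_ge0//.
by rewrite sqrtr_sqr gtr0_norm// mul1r invfM mulrC mulrA divff ?mul1r// gt_eqF.
Qed.

Lemma normal_prob_itv_le s a b : 0 < s -> a <= b ->
  (normal_prob 0 s `[a, b] <= (normal_peak s * (b - a))%:E)%E.
Proof.
move=> s0 ab; have s_neq0 : s != 0 by rewrite gt_eqF.
apply: (@le_trans _ _ (\int[lebesgue_measure]_(x in `[a, b]) (normal_peak s)%:E)%E).
  apply: ge0_le_integral => //=.
  - by move=> x _; rewrite lee_fin normal_pdf_ge0.
  - by apply/measurable_EFinP/measurable_funTS; exact: measurable_normal_pdf.
  - by move=> x _; rewrite lee_fin normal_pdf_ub.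
rewrite integral_cst//= lebesgue_measure_itv/= lte_fin.
case: ltP => [_|ba]; first by rewrite EFinM EFinB.
by rewrite mule0 lee_fin mulr_ge0 ?subr_ge0// normal_peak_ge0.
Qed.

(** On an interval from [- 2 * s] to [- s] the density is at least its peak times [expR (- 2)]; the
    peak scales like the inverse of [s], so the bound does not depend on [s]. *)
Lemma normal_prob_tail s a : 0 < s -> a <= s ->
  ((normal_peak 1 * expR (- 2))%:E <= normal_prob 0 s `]-oo, (- a)%R])%E.
Proof.
move=> s0 sa; have s_neq0 : s != 0 by rewrite gt_eqF.
have mpdf D : measurable_fun D (fun x => (normal_pdf 0 s x)%:E).
  by apply/measurable_EFinP/measurable_funTS; exact: measurable_normal_pdf.
apply: (@le_trans _ _ (normal_prob 0 s `[- 2 * s, - s])); last first.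
  apply: ge0_subset_integral => //=.
  - exact: mpdf.
  - by move=> x _; rewrite lee_fin normal_pdf_ge0.
  - by move=> x /=; rewrite !in_itv/= => /andP[_ xs]; lra.
have -> : ((normal_peak 1 * expR (- 2))%:E =
    \int[lebesgue_measure]_(x in `[(- 2 * s)%R, (- s)%R]) (normal_peak s * expR (- 2))%:E)%E.
  rewrite integral_cst//= lebesgue_measure_itv/= lte_fin ifT; last lra.
  rewrite -EFinB -EFinM -(normal_peakE s0); congr EFin.
  by rewrite (_ : - s - - 2 * s = s) 1?mulrAC//; lra.
apply: ge0_le_integral => //=.
- by move=> x _; rewrite lee_fin mulr_ge0 ?expR_ge0 ?normal_peak_ge0.
- exact: mpdf.
- move=> x; rewrite in_itv/= => /andP[xl xr].
  rewrite lee_fin normal_pdfE// ler_wpM2l ?normal_peak_ge0// ler_expR subr0 mulNr lerN2.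
  rewrite ler_pdivrMr; last by rewrite pmulrn_lgt0// exprn_gt0.
  have : 0 <= (2 * s + x) * (2 * s - x) by rewrite mulr_ge0//; lra.
  by rewrite mulr2n; lra.
Qed.

End normal_bounds.

(** * A Gaussian plus an independent variable has no atom *)

Section anti_concentration.
Context {R : realType} {d : measure_display} {Omega : measurableType d}.
Variable P : probability Omega R.

(** The pair has a product law; for each value of [W] the variable [Y] must fall in an interval of
    length [b - a], where its density is bounded by the peak. *)
Lemma normal_anti_concentration (Y W : Omega -> R) s a b :
  measurable_fun setT Y -> measurable_fun setT W -> 0 < s -> a <= b ->
  (forall A, measurable A -> P (Y @^-1` A) = normal_prob 0 s A) ->
  (forall A C, measurable A -> measurable C ->
    P (Y @^-1` A `&` W @^-1` C) = (P (Y @^-1` A) * P (W @^-1` C))%E) ->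
  (P [set w | (a <= Y w + W w <= b)%R] <= (normal_peak s * (b - a))%:E)%E.
Proof.
move=> mY mW s0 ab Ynormal indYW.
pose Y' : {mfun Omega >-> R} := mfun_Sub (mem_set mY).
pose W' : {mfun Omega >-> R} := mfun_Sub (mem_set mW).
pose WY' : {mfun Omega >-> (R * R)%type} := mfun_Sub (mem_set (measurable_fun_pair mW mY)).
pose S : set (R * R) := [set p | a <= p.2 + p.1 <= b].
have mS : measurable S.
  rewrite (_ : S = (fun p : R * R => p.2 + p.1) @^-1` `[a, b]); last first.
    by apply/seteqP; split => p /=; rewrite in_itv.
  rewrite -[X in measurable X]setTI.
  apply: (_ : measurable_fun setT _) => //.
  exact: measurable_funD.
rewrite -[leLHS]/(distribution P WY' S) -(@product_measure_unique _ _ _ _ _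
  (distribution P W') (distribution P Y'))//; last first.
  move=> C A mC mA; rewrite /distribution /pushforward/= muleC -indYW// setIC.
  by congr (P _).
rewrite /product_measure1.
apply: (@le_trans _ _ (\int[distribution P W']_x (normal_peak s * (b - a))%:E)%E); last first.
  by rewrite integral_cst//= probability_setT mule1.
apply: ge0_le_integral => //=.
- exact: measurable_fun_xsection.
- move=> w _; rewrite /distribution /pushforward.
  rewrite Ynormal; last exact: measurable_xsection.
  rewrite (_ : xsection S w = `[a - w, b - w]%classic).
    rewrite (le_trans (normal_prob_itv_le s0 _))//; first by rewrite lerB.
    by rewrite lee_fin opprB addrA subrK.
  by apply/seteqP; split => y; rewrite /xsection/= inE/= in_itv/= /S/= lerBlDr lerBrDr.
Qed.

End anti_concentration.

Lemma bigsetIE {T : Type} n (F : 'I_n -> set T) :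
  \big[setI/setT]_(i < n) F i = [set w | forall i, F i w].
Proof.
rewrite -bigcap_seq; apply/seteqP; split => w Fw i; last by move=> _; exact: Fw.
by apply: Fw => /=; rewrite mem_index_enum.
Qed.

Lemma prode_le {R : realDomainType} n (x : 'I_n -> \bar R) (q : R) : 0 <= q ->
  (forall i, (0 <= x i <= q%:E)%E) -> (\prod_(i < n) x i <= (q ^+ n)%:E)%E.
Proof.
move=> q0; elim: n x => [|n IH] x xq; first by rewrite big_ord0 expr0.
rewrite big_ord_recl exprS EFinM; have /andP[x0 xq0] := xq ord0.
apply: lee_pmul => //; last by apply: IH.
by apply: prode_ge0 => i _; have /andP[] := xq (lift ord0 i).
Qed.

(** * Brownian motion becomes non-positive immediately *)

Section positive_excursion.
Context {R : realType} {d : measure_display} {Omega : measurableType d}.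
Variable P : probability Omega R.
Variable B : R -> Omega -> R.
Hypothesis BM : brownian_motion P B.

Lemma le_negligible (N : set Omega) :
  (forall e, 0 < e -> exists2 S, measurable S & N `<=` S /\ (P S <= e%:E)%E) ->
  P.-negligible N.
Proof.
move=> H; have /boolp.choice[S SP] (k : nat) :
    exists S, [/\ measurable S, N `<=` S & (P S <= k.+1%:R^-1%:E)%E].
  by have [S mS [NS PS]] := H k.+1%:R^-1 ltac:(by []); exists S.
have mS : measurable (\bigcap_k S k).
  by apply: bigcapT_measurable => k; have [] := SP k.
exists (\bigcap_k S k); split => //.
  apply/eqP; rewrite -measure_le0; apply/lee_addgt0Pr => e e0; rewrite add0e.
  have [k ke] : exists k, k.+1%:R^-1 < e.
    near \oo => k; exists k; near: k; exact: near_infty_natSinv_lt (PosNum e0).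
  have [mSk _ PSk] := SP k.
  apply: (@le_trans _ _ (P (S k))).
    by rewrite le_measure ?inE//; exact: bigcap_inf.
  by apply: (le_trans PSk); rewrite lee_fin ltW.
by move=> w Nw k _; have [_ + _] := SP k; exact.
Unshelve. all: by end_near. Qed.

Let mB t : 0 <= t -> measurable_fun setT (B t).
Proof. by have [+ _ _ _ _] := BM; exact. Qed.

Let mBray t a : 0 <= t -> measurable [set w | a < B t w].
Proof.
move=> t0; rewrite (_ : [set _ | _] = B t @^-1` `]a, +oo[); last first.
  by apply/seteqP; split => w /=; rewrite in_itv/= andbT.
by rewrite -[X in measurable X]setTI; exact: mB.
Qed.

Lemma brownian_small_time (a e r : R) : 0 < a -> 0 < e -> 0 < r ->
  exists u, [/\ 0 < u, u <= r & (P [set w | (a < B u w)%R] <= e%:E)%E].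
Proof.
move=> a0 e0 r0; have [_ B0 cB _ _] := BM.
pose u k : R := r * k.+1%:R^-1.
have u0 k : 0 < u k by rewrite mulr_gt0.
(* These events decrease to the empty set, by continuity of the paths at time 0. *)
pose F k := \bigcup_(n in [set n | (k <= n)%N]) [set w | a < B (u n) w].
have mF k : measurable (F k).
  by apply: bigcup_measurable => n _; apply: mBray; exact: ltW.
have Fnd k : F k.+1 `<=` F k.
  by move=> w [n /= kn wn]; exists n => //=; exact: ltnW.
have F0 : \bigcap_k F k = set0.
  apply/seteqP; split => // w Fw.
  have [dl d0 db] := within_continuous_dist (cB w) (lexx 0) a0.
  have [k ke] : exists k, k.+1%:R^-1 < dl / r.
    near \oo => k; exists k; near: k.
    exact: near_infty_natSinv_lt (PosNum (divr_gt0 d0 r0)).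
  have [n /= kn] := Fw k I.
  have un : u n < dl.
    rewrite /u mulrC -ltr_pdivlMr//; apply: le_lt_trans ke.
    by rewrite lef_pV2 ?posrE// ler_nat.
  have := db _ (ltW (u0 n)); rewrite subr0 gtr0_norm// => /(_ un).
  by rewrite B0 subr0 ltr_norml => /andP[_]; lra.
have [k] := fine_prob_bigcap P mF Fnd e0.
rewrite F0 measure0 add0r => PFk; exists (u k); split => //.
  by rewrite /u ger_pMr// invf_le1// ler1n.
apply: (@le_trans _ _ (P (F k))).
  apply: le_measure; rewrite ?inE//; first by apply: mBray; exact: ltW.
  by move=> w wk; exists k => /=.
by rewrite -(fineK (fin_num_measure P _ (mF k))) lee_fin.
Unshelve. all: by end_near. Qed.

Let c : R := normal_peak 1 * expR (- 2).

(* Along times decreasing so fast that each value is negligible with respect to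
   the next increment, staying positive forces independent events of
   probability at most [1 - c]. *)
Lemma brownian_positive_negligible t : 0 < t ->
  P.-negligible [set w | forall u, 0 < u <= t -> 0 < B u w].
Proof.
move=> t0; apply: le_negligible => e e0; have [_ B0 cB Bnormal Bindep] := BM.
have c0 : 0 < c by rewrite mulr_gt0 ?expR_gt0// normal_peak_gt0.
have c1 : c <= 1.
  have := normal_prob_tail ltr01 (lexx (1 : R)) => /le_trans.
  by move=> /(_ 1%E); rewrite lee_fin; apply; exact: probability_le1.
have [n cn] : exists n, (1 - c) ^+ n < e / 2.
  have : geometric 1 (1 - c) k @[k --> \oo] --> 0.
    by apply: cvg_geometric; rewrite ger0_norm; lra.
  move=> /cvgr_dist_lt/(_ (e / 2)) H.
  near \oo => n; exists n.
  have : `|0 - geometric 1 (1 - c) n| < e / 2 by near: n; apply: H; lra.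
  by rewrite /geometric/= mul1r sub0r normrN ger0_norm// exprn_ge0//; lra.
(* Half of [e] pays for the [n] independent increments, the other half is shared among [n]
   exceptional events. *)
pose dl := e / 2 / n.+1%:R; have dl0 : 0 < dl by rewrite !divr_gt0.
have /boolp.choice[phi phiP] (r : R) : exists u, 0 < r ->
    [/\ 0 < u, u <= r / 2 & (P [set w | (Num.sqrt (r / 2) < B u w)%R] <= dl%:E)%E].
  have [r0|r0] := ltP 0 r; last by exists 0.
  have r2 : 0 < r / 2 by lra.
  have sr2 : 0 < Num.sqrt (r / 2) by rewrite sqrtr_gt0.
  by have [u uP] := brownian_small_time sr2 dl0 r2; exists u.
pose s k := iter k phi t.
have s0 k : 0 < s k by elim: k => //= k /phiP[].
have sS k : s k.+1 <= s k / 2 by have [] := phiP _ (s0 k).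
have s_nd : nonincreasing_seq s.
  by apply/nonincreasing_seqP => k; have := sS k; have := s0 k; lra.
(* The times [s k] decrease, whereas independence of increments is stated for increasing times. *)
pose th i := s (n - i)%N.
have th_nd : nondecreasing_seq th.
  by move=> i j ij; apply: s_nd; exact: leq_sub2l.
pose a k := Num.sqrt (s k / 2).
have ord_subn (i : 'I_n) : (n - i)%N = (n - i.+1).+1 by rewrite subnSK.
pose A (i : 'I_n) : set R := `]- a (n - i.+1)%N, +oo[%classic.
pose D (i : 'I_n) := B (th i.+1) \- B (th i).
have mD i : measurable_fun setT (D i).
  by apply: measurable_funB; apply: mB; exact: ltW (s0 _).
have mDA i : measurable (D i @^-1` A i).
  by rewrite -[X in measurable X]setTI; apply: (mD i) => //; exact: measurable_itv.
have DA i : (P (D i @^-1` A i) <= (1 - c)%:E)%E.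
  rewrite Bnormal; last 3 first.
  - exact: ltW (s0 _).
  - by rewrite /th ord_subn; have := sS (n - i.+1)%N; have := s0 (n - i.+1)%N; lra.
  - exact: measurable_itv.
  rewrite /th ord_subn /A /a.
  have := sS (n - i.+1)%N; have := s0 (n - i.+1)%N; move: (n - i.+1)%N => k sk sk1.
  (* As [s k.+1 <= s k / 2], the standard deviation of the increment is at least [a k], so it is at
     most [- a k] with probability at least [c]. *)
  rewrite -[X in normal_prob _ _ X]setCK setCitvr probability_setC// EFinB leeB//.
  apply: normal_prob_tail; first by rewrite sqrtr_gt0; lra.
  by rewrite ler_sqrt; lra.
pose E k := [set w | a k < B (s k.+1) w].
have mE k : measurable (E k) by apply: mBray; exact: ltW (s0 _).
have mDA' : measurable (\big[setI/setT]_(i < n) (D i @^-1` A i)).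
  by apply: bigsetI_measurable => i _; exact: mDA.
have mE' : measurable (\big[setU/set0]_(k < n) E k).
  by apply: bigsetU_measurable => k _; exact: mE.
exists (\big[setI/setT]_(i < n) (D i @^-1` A i) `|` \big[setU/set0]_(k < n) E k).
  exact: measurableU.
split.
  (* Outside the [E k], positivity of [B (s k)] and [B (s k.+1) <= a k] force each increment above
     [- a k]. *)
  move=> w pos; have [Ew|nEw] := pselect ((\big[setU/set0]_(k < n) E k) w); [by right|left].
  rewrite bigsetIE => i; rewrite /D /A /= in_itv/= andbT /th ord_subn.
  have si k : s k <= t by have := s_nd _ _ (leq0n k).
  have := pos (s (n - i.+1)%N); rewrite s0 si => /(_ isT).
  have : B (s (n - i.+1).+1) w <= a (n - i.+1)%N.
    rewrite leNgt; apply/negP => aB; apply: nEw.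
    have nin : (n - i.+1 < n)%N by rewrite -ord_subn leq_subr.
    exact: (bigsetU_sup nin).
  lra.
apply: (le_trans (measureU2 _ _ _)) => //.
have -> : e = e / 2 + e / 2 by lra.
rewrite EFinD; apply: leeD.
  rewrite [leLHS](Bindep n th (ltW (s0 _)) th_nd A (fun=> measurable_itv _)).
  apply: (@le_trans _ _ ((1 - c) ^+ n)%:E); last by rewrite lee_fin ltW.
  by apply: prode_le; [lra|move=> i; rewrite measure_ge0 DA].
apply: (le_trans (Boole_inequality _ _)); first by move=> k _; exact: mE.
apply: (@le_trans _ _ (\sum_(k < n) dl%:E)%E).
  by apply: lee_sum => k _; have [] := phiP _ (s0 k).
rewrite sumEFin lee_fin sumr_const card_ord -[leLHS]mulr_natr.
rewrite /dl mulrAC ler_pdivrMr// ler_wpM2l ?ler_nat//; lra.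
Unshelve. all: by end_near. Qed.
End positive_excursion.

(** * Independence of an early value from the initial condition and later increments *)

Section independence.
Context {R : realType} {d : measure_display} {Omega : measurableType d}.
Variable P : probability Omega R.
Local Open Scope ereal_scope.

(** Dynkin's theorem: independence of [F] passes from a generating pi-system to its
    sigma-algebra. *)
Lemma independent_g_sigma_algebra (F : set Omega) (G : set_system Omega) :
  measurable F -> G `<=` measurable -> setI_closed G ->
  (forall E, G E -> P (F `&` E) = P F * P E) ->
  forall E, <<s G >> E -> P (F `&` E) = P F * P E.
Proof.
move=> mF Gm GI GP.
have mG E : <<s G >> E -> measurable E.
  by apply: smallest_sub => //; exact: sigma_algebra_measurable.
have Pfin E : measurable E -> P E \is a fin_num by move=> ?; exact: fin_num_measure.
apply: (@dynkin_induction _ (g_sigma_algebraType G) G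
  (fun E => P (F `&` E) = P F * P E)) => //.
- by rewrite setIT probability_setT mule1.
- move=> S /mG mS FS; rewrite probability_setC// muleBr ?Pfin// mule1 -FS.
  by rewrite -setDE measureD// -ge0_fin_numE// Pfin.
- move=> E mE tE FE; have {}mE k : d.-measurable (E k) by exact: mG (mE k).
  rewrite setI_bigcupr !measure_bigcup//; last first.
  - exact: trivIset_setIl.
  - by move=> k _; exact: measurableI.
  rewrite -(fineK (Pfin _ mF)) -nneseriesZl//; apply: eq_eseriesr => k _.
  by rewrite fineK ?Pfin//; exact: FE.
Qed.

End independence.

Section increments.
Context {R : realType} {d : measure_display} {Omega : measurableType d}.
Variables (P : probability Omega R) (B : R -> Omega -> R) (X : Omega -> R).
Hypothesis BM : brownian_motion P B.
Hypothesis mX : measurable_fun setT X.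
Hypothesis indXB : independent_of_process P X B.

Let mB t : 0 <= t -> measurable_fun setT (B t).
Proof. by have [+ _ _ _ _] := BM; exact. Qed.

Lemma independent_increments n (th : nat -> R) C (A : 'I_n -> set R) :
  0 <= th 0%N -> nondecreasing_seq th ->
  measurable C -> (forall i, measurable (A i)) ->
  (P (X @^-1` C `&` \big[setI/setT]_(i < n) ((B (th i.+1) \- B (th i))%R @^-1` A i)) =
  P (X @^-1` C) * \prod_(i < n) P ((B (th i.+1) \- B (th i))%R @^-1` A i))%E.
Proof.
move=> th0 th_nd mC mA; have [_ _ _ _ Bindep] := BM.
have thi i : 0 <= th i by apply: le_trans th0 (th_nd _ _ (leq0n i)).
pose S := \bigcup_(t in [set t : R | 0 <= t]) preimage_set_system setT (B t) measurable.
have mBS t : 0 <= t -> measurable_fun (setT : set (g_sigma_algebraType S)) (B t).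
  move=> t0 _ C' mC'; apply: sub_gen_smallest; exists t => //.
  by exists C'.
rewrite indXB; first by congr (_ * _)%E; exact: Bindep.
- by exists C => //; rewrite setTI.
- apply: (@bigsetI_measurable _ (g_sigma_algebraType S)) => i _.
  rewrite -[X in measurable X]setTI.
  by apply: (measurable_funB (mBS _ (thi i.+1)) (mBS _ (thi i))).
Qed.

Variables (m : nat) (th : nat -> R).
Hypothesis th0 : th 0%N = 0.
Hypothesis th_nd : nondecreasing_seq th.

Let D i := B (th i.+1) \- B (th i).

(** A pi-system generating the sigma-algebra of [X] and of [m] increments from [th 1%N] on; the
    shift in [D i.+1] leaves out the first increment, which is [B (th 1%N)]. *)
Definition later_events : set_system Omega :=
  [set E | exists C, exists A : 'I_m -> set R,
    [/\ measurable C, forall i, measurable (A i) &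
    E = X @^-1` C `&` \big[setI/setT]_(i < m) (D i.+1 @^-1` A i)]].

Let thi i : 0 <= th i.
Proof. by rewrite -th0; apply: th_nd; exact: leq0n. Qed.

Let mD i : measurable_fun setT (D i).
Proof. by apply: measurable_funB; apply: mB. Qed.

Lemma later_events_measurable : later_events `<=` measurable.
Proof.
move=> _ [C [A [mC mA ->]]]; apply: measurableI.
  by rewrite -[X in measurable X]setTI; apply: mX.
by apply: bigsetI_measurable => i _; rewrite -[X in measurable X]setTI; apply: mD.
Qed.

Lemma setI_closed_later_events : setI_closed later_events.
Proof.
move=> _ _ [C [A [mC mA ->]]] [C' [A' [mC' mA' ->]]].
exists (C `&` C'), (fun i => A i `&` A' i); split.
- exact: measurableI.
- by move=> i; exact: measurableI.
- rewrite setIACA preimage_setI; congr (_ `&` _); rewrite !bigsetIE.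
  apply/seteqP; split => w /=.
    by move=> [a a'] i; split; [exact: a|exact: a'].
  by move=> a; split => i; have [] := a i.
Qed.

Lemma later_events_independent F E : measurable F -> <<s later_events >> E ->
  (P (B (th 1%N) @^-1` F `&` E) = P (B (th 1%N) @^-1` F) * P E)%E.
Proof.
have DB : D 0 = B (th 1%N).
  by apply/funext => w; have [_ B0 _ _ _] := BM; rewrite /D/= th0 B0 subr0.
move=> mF; apply: independent_g_sigma_algebra.
- by rewrite -[X in measurable X]setTI; apply: mB.
- exact: later_events_measurable.
- exact: setI_closed_later_events.
move=> _ [C [A [mC mA ->]]].
pose A' F' (i : 'I_m.+1) := if unlift ord0 i is Some j then A j else F'.
have A'0 F' : A' F' ord0 = F' by rewrite /A' unlift_none.
have A'S F' i : A' F' (lift ord0 i) = A i by rewrite /A' liftK.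
have mA' F' : measurable F' -> forall i, measurable (A' F' i).
  by move=> mF' i; rewrite /A'; case: unliftP.
have H F' : measurable F' ->
    P (X @^-1` C `&` (D 0 @^-1` F' `&` \big[setI/setT]_(i < m) (D i.+1 @^-1` A i))) =
    (P (X @^-1` C) * (P (D 0%N @^-1` F') * \prod_(i < m) P (D i.+1 @^-1` A i)))%E.
  move=> mF'.
  have := @independent_increments m.+1 th C (A' F') (thi 0%N) th_nd mC (mA' F' mF').
  rewrite !big_ord_recl !A'0.
  rewrite (eq_bigr (fun i : 'I_m => D i.+1 @^-1` A i)) => [|i _]; last by rewrite A'S.
  by rewrite (eq_bigr (fun i : 'I_m => P (D i.+1 @^-1` A i))) => [|i _]; last by rewrite A'S.
(* Leaving the first increment free gives the probability of the later event alone. *)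
have := H _ measurableT.
rewrite preimage_setT setTI probability_setT mul1e => ->.
by rewrite -DB setICA H// muleCA.
Qed.
End increments.

Fixpoint running_min {R : realType} {T : Type} (V : nat -> T -> R) n (w : T) : R :=
  if n is k.+1 then Num.min (running_min V k w) (V k.+1 w) else V 0%N w.

Section running_min.
Context {R : realType} {T : Type}.
Variable V : nat -> T -> R.

Lemma running_min_le n j w : (j <= n)%N -> running_min V n w <= V j w.
Proof.
elim: n => [|n IH]; first by rewrite leqn0 => /eqP ->.
rewrite leq_eqVlt ltnS => /predU1P[->|/IH]; first by rewrite /= ge_min lexx orbT.
by move=> H; rewrite /= ge_min H.
Qed.

Lemma le_running_min n c w : (forall j, (j <= n)%N -> c <= V j w) ->
  c <= running_min V n w.
Proof.
elim: n => [|n IH] H; first exact: H.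
by rewrite /= le_min IH ?H// => j jn; rewrite H// ltnW.
Qed.

End running_min.

(** * Minima of the path on grids of a time interval away from 0 *)

Section touching.
Context {R : realType} {d : measure_display} {Omega : measurableType d}.
Variables (P : probability Omega R) (B : R -> Omega -> R) (X : Omega -> R).
Hypothesis BM : brownian_motion P B.
Hypothesis mX : measurable_fun setT X.
Hypothesis indXB : independent_of_process P X B.
Variable l : R -> R.
Hypothesis Ml : M_space l.

Let mB t : 0 <= t -> measurable_fun setT (B t).
Proof. by have [+ _ _ _ _] := BM; exact. Qed.

(** Index 0 is time 0 and index 1 is time [a], so that the first increment of [B] along the grid is
    [B a]. *)
Let grid (a h : R) i := if i is j.+1 then a + j%:R * h else 0.

Let grid_nd a h : 0 <= a -> 0 <= h -> nondecreasing_seq (grid a h).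
Proof.
move=> a0 h0; apply/nondecreasing_seqP => -[|j] /=; first by rewrite mul0r addr0.
by rewrite lerD2l ler_wpM2r// ler_nat.
Qed.

(** Subtracting [B a] leaves only [X], increments after time [a] and a constant. *)
Let V a h j w := X w + (B (grid a h j.+1) w - B a w) - l (grid a h j.+1).

Let mV a h m : 0 <= a -> 0 <= h ->
  measurable_fun (setT : set (g_sigma_algebraType (later_events B X m (grid a h))))
    (running_min (V a h) m).
Proof.
move=> a0 h0; set G := later_events _ _ _ _.
have mC C : measurable C -> <<s G >> (X @^-1` C).
  move=> mC; apply: sub_gen_smallest; exists C, (fun=> setT); split => //.
  by rewrite bigsetIE; apply/seteqP; split => w //= [].
have mX' : measurable_fun (setT : set (g_sigma_algebraType G)) X.
  by move=> _ C /mC; rewrite setTI.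
have mDi i : (i < m)%N -> measurable_fun (setT : set (g_sigma_algebraType G))
    (B (grid a h i.+2) \- B (grid a h i.+1)).
  move=> im _ C mC'; rewrite setTI; apply: sub_gen_smallest.
  exists setT, (fun k : 'I_m => if k == i :> nat then C else setT); split => //.
    by move=> k; case: ifP.
  rewrite bigsetIE; apply/seteqP; split => w /=; last first.
    by move=> [_ /(_ (Ordinal im))]; rewrite eqxx.
  by move=> Cw; split => // k; case: ifPn => // /eqP ->.
have mVj j : (j <= m)%N -> measurable_fun (setT : set (g_sigma_algebraType G)) (V a h j).
  move=> jm; apply: measurable_funB => //; apply: measurable_funD => //.
  elim: j jm => [|j IH] jm.
    rewrite (_ : (fun w => _) = cst 0)//; apply/funext => w /=.
    by rewrite mul0r addr0 subrr.
  rewrite (_ : (fun w => _) = (fun w => B (grid a h j.+1) w - B a w) \+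
      (B (grid a h j.+2) \- B (grid a h j.+1))).
    by apply: measurable_funD; [apply: IH; exact: ltnW|exact: mDi].
  by apply/funext => w /=; lra.
suff H n : (n <= m)%N ->
    measurable_fun (setT : set (g_sigma_algebraType G)) (running_min (V a h) n).
  exact: H.
elim: n => [|n IH] nm; first exact: mVj.
by apply: measurable_minr; [apply: IH; exact: ltnW|exact: mVj].
Qed.

Let grid_hits (a t c : R) m : set Omega :=
  [set w | 0 <= B a w + running_min (V a ((t - a) / m.+1%:R)) m.+1 w <= c].

Let mW a h m : 0 <= a -> 0 <= h -> measurable_fun setT (running_min (V a h) m).
Proof.
move=> a0 h0 _ C mC; have := @mV a h m a0 h0 measurableT C mC.
apply: smallest_sub; first exact: sigma_algebra_measurable.
exact: (later_events_measurable BM mX (erefl : grid a h 0 = 0) (grid_nd a0 h0)).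
Qed.

Let measurable_grid_hits a t c m : 0 < a -> a <= t -> measurable (grid_hits a t c m).
Proof.
move=> a0 at_; have h0 : 0 <= (t - a) / m.+1%:R by rewrite divr_ge0// subr_ge0.
rewrite (_ : grid_hits _ _ _ _ =
  (B a \+ running_min (V a ((t - a) / m.+1%:R)) m.+1) @^-1` `[0, c]); last first.
  by apply/seteqP; split => w /=; rewrite in_itv.
rewrite -[X in measurable X]setTI.
by apply: (measurable_funD (mB (ltW a0))
  (@mW a ((t - a) / m.+1%:R) m.+1 (ltW a0) h0)).
Qed.

Let grid_hits_le a t c m : 0 < a -> a <= t -> 0 <= c ->
  (P (grid_hits a t c m) <= (normal_peak (Num.sqrt a) * c)%:E)%E.
Proof.
move=> a0 at_ c0; have h0 : 0 <= (t - a) / m.+1%:R by rewrite divr_ge0// subr_ge0.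
have [_ B0 _ Bnormal _] := BM.
have BE : B a \- B 0 = B a by apply/funext => w /=; rewrite B0 subr0.
rewrite -[c in leRHS]subr0; apply: normal_anti_concentration => //.
- exact/mB/ltW.
- exact: (@mW a ((t - a) / m.+1%:R) m.+1 (ltW a0) h0).
- by rewrite sqrtr_gt0.
- move=> A mA; rewrite -[a in normal_prob _ (Num.sqrt a)]subr0 -Bnormal//.
  by rewrite BE.
- move=> A C mA mC.
  have Ea : grid a ((t - a) / m.+1%:R) 1 = a by rewrite /= mul0r addr0.
  have := later_events_independent BM mX indXB (erefl : grid a ((t - a) / m.+1%:R) 0 = 0)
    (grid_nd (ltW a0) h0) (m := m.+1) mA.
  rewrite Ea; apply.
  by have := @mV a ((t - a) / m.+1%:R) m.+1 (ltW a0) h0 measurableT C mC; rewrite setTI.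
Qed.

(* [X + B - l] on [[a, t]] is the sum of [B a] and of a process independent of
   [B a], so its minimum has no atom; the minimum is approximated on grids. *)
Lemma touching_negligible a t : 0 < a -> a <= t ->
  P.-negligible [set w | (exists2 u, a <= u <= t & X w + B u w - l u <= 0) /\
    forall u, a <= u <= t -> 0 <= X w + B u w - l u].
Proof.
move=> a0 at_; apply: le_negligible => e e0.
have [_ _ cB _ _] := BM; have [_ nd _] := Ml.
have pk : 0 < normal_peak (Num.sqrt a).
  by rewrite normal_peak_gt0// gt_eqF// sqrtr_gt0.
(* With this width the anti-concentration bound equals [e / 2]. *)
pose c := e / 2 / normal_peak (Num.sqrt a).
have c0 : 0 < c by rewrite !divr_gt0.
pose F k := \bigcap_(m in [set m | (k <= m)%N]) grid_hits a t c m.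
have mF k : measurable (F k).
  by apply: bigcap_measurable => [|m _]; [exists k => /=|exact: measurable_grid_hits].
have Fnd k : F k `<=` F k.+1 by move=> w Fw m /= km; apply: Fw => /=; exact: ltnW.
exists (\bigcup_k F k); first exact: bigcupT_measurable.
split; last first.
  have e2 : 0 < e / 2 by lra.
  have [k PF] := fine_prob_bigcup P mF Fnd e2.
  rewrite -(fineK (fin_num_measure P _ (bigcupT_measurable _ mF))) lee_fin.
  apply: (le_trans PF); rewrite -[leRHS](_ : e / 2 + e / 2 = e) ?lerD2r; last lra.
  rewrite -lee_fin fineK ?fin_num_measure//.
  apply: (@le_trans _ _ (P (grid_hits a t c k))).
    apply: le_measure; rewrite ?inE//; first exact: measurable_grid_hits.
    by move=> w; apply => /=.
  apply: (le_trans (grid_hits_le _ a0 at_ (ltW c0))).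
  by rewrite lee_fin /c mulrC divfK// gt_eqF.
move=> w [[u /andP[au ut] uE] pos].
have u0 : 0 <= u by lra.
have [r r0 br] := within_continuous_dist (cB w) u0 c0.
(* From index [k] on the mesh is below [r]; adding 1 keeps the divisor positive when [a = t]. *)
have [k kr] : exists k, k.+1%:R^-1 < r / (t - a + 1).
  have q0 : 0 < r / (t - a + 1) by rewrite divr_gt0//; lra.
  near \oo => k; exists k; near: k; exact: near_infty_natSinv_lt (PosNum q0).
exists k => // m /= km; rewrite /grid_hits/=.
set h := (t - a) / m.+1%:R.
have h0 : 0 <= h by rewrite divr_ge0// subr_ge0.
have hr : h < r.
  have : m.+1%:R^-1 <= k.+1%:R^-1 :> R by rewrite lef_pV2 ?posrE// ler_nat.
  move=> /le_lt_trans/(_ kr); rewrite ltr_pdivlMr; last lra.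
  apply: le_lt_trans; rewrite mulrDr mulr1 mulrC lerDl invr_ge0//.
have mh : a + m.+1%:R * h = t by rewrite /h mulrC divfK// addrC subrK.
have VE j : B a w + V a h j w =
    X w + B (grid a h j.+1) w - l (grid a h j.+1) by rewrite /V; lra.
have gt_le j : (j <= m.+1)%N -> a <= grid a h j.+1 <= t.
  move=> jm; rewrite /grid lerDl mulr_ge0//= -mh lerD2l.
  by rewrite ler_wpM2r// ler_nat.
have rm_ge : - B a w <= running_min (V a h) m.+1 w.
  apply: le_running_min => j jm.
  by rewrite -(lerD2l (B a w)) subrr VE; exact: pos (gt_le j jm).
apply/andP; split; first by rewrite -lerBlDl sub0r.
(* The first grid point from [u] on is less than [r] away: there [B] has risen by less than [c] and
   [l] has not decreased, so the path is at most [c]. *)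
have exj : exists j, u <= grid a h j.+1 by exists m.+1; rewrite /grid mh.
have [j uj jmin] := ex_minnP exj.
have jm : (j <= m.+1)%N by apply: jmin; rewrite /grid mh.
have ju : grid a h j.+1 < u + r.
  case: j uj jmin jm => [|j] uj jmin jm.
    by rewrite /= mul0r addr0; lra.
  have : grid a h j.+1 < u.
    by rewrite ltNge; apply/negP => /jmin; rewrite ltnn.
  rewrite /grid -[j.+1]addn1 natrD mulrDl mul1r addrA => jh.
  by rewrite ltrD.
have g0 : 0 <= grid a h j.+1 by have /andP[] := gt_le j jm; lra.
have := br _ g0; rewrite ger0_norm ?subr_ge0// ltrBlDl => /(_ ju).
rewrite ltr_norml => /andP[_ bj].
have := running_min_le (V a h) w jm; rewrite -(lerD2l (B a w)) VE => rmj.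
apply: (le_trans rmj); have := nd _ _ uj; move: bj.
by move: (grid a h j.+1) => g {kr mh rmj rm_ge}; lra.
Unshelve. all: by end_near. Qed.

End touching.

Section no_touching.
Context {R : realType} {d : measure_display} {Omega : measurableType d}.
Variables (P : probability Omega R) (B : R -> Omega -> R).
Hypothesis BM : brownian_motion P B.

Lemma independent_of_processD X c :
  independent_of_process P X B -> independent_of_process P (fun w => X w + c) B.
Proof.
move=> ind _ F [A mA <-] mF; apply: ind => //.
exists ((fun r => r + c) @^-1` A) => //.
rewrite -[X in measurable X]setTI.
by apply: (_ : measurable_fun setT _) => //; exact: measurable_funD.
Qed.

Let mB t : 0 <= t -> measurable_fun setT (B t).
Proof. by have [+ _ _ _ _] := BM; exact. Qed.

Let cB w : {within `[0, +oo[, continuous (B ^~ w)}.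
Proof. by have [_ _ + _ _] := BM; exact. Qed.

Variable X : Omega -> R.
Hypothesis mX : measurable_fun setT X.
Hypothesis indXB : independent_of_process P X B.

Lemma hits_crosses_negligible l t : M_space l -> 0 < t ->
  P.-negligible (hits X B l t `\` crosses X B l t).
Proof.
move=> Ml t0; have [_ nd _] := Ml; have [_ B0 _ _ _] := BM.
pose touch a := [set w | (exists2 u, a <= u <= t & X w + B u w - l u <= 0) /\
    forall u, a <= u <= t -> 0 <= X w + B u w - l u].
apply: (@negligibleS _ _ _ _ ([set w | forall u, 0 < u <= t -> 0 < B u w] `|`
    \bigcup_k touch (t / k.+1%:R))); last first.
  apply: negligibleU; first exact: brownian_positive_negligible.
  apply: negligible_bigcup => k; apply: touching_negligible => //.
    by rewrite divr_gt0.
  by rewrite ler_pdivrMr// ler_peMr ?ler1n// ltW.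
move=> w [[s /andP[s0 st] sE] ncross].
have Z0 u : 0 <= u <= t -> 0 <= X w + B u w - l u.
  by move=> ut; rewrite leNgt; apply/negP => Zu; apply: ncross; exists u.
(* Either a positive time hits, and the path touches 0 on an interval bounded away from time 0, or
   only time 0 does; then [X w <= l 0], and a path positive afterwards forces [B] to be positive. *)
have [[u /andP[u0 ut] uE]|pos] :=
    pselect (exists2 u, 0 < u <= t & X w + B u w - l u <= 0); [right|left].
  have [k ke] : exists k, k.+1%:R^-1 < u / t.
    near \oo => k; exists k; near: k.
    exact: near_infty_natSinv_lt (PosNum (divr_gt0 u0 t0)).
  have tk0 : 0 < t / k.+1%:R by rewrite divr_gt0.
  have tku : t / k.+1%:R <= u by rewrite mulrC -ler_pdivlMr// ltW.
  exists k => //; split; first by exists u; rewrite ?tku.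
  by move=> v /andP[tkv vt]; apply: Z0; rewrite vt (le_trans (ltW tk0)).
have s_eq0 : s = 0.
  apply/eqP; rewrite eq_le s0 andbT leNgt; apply/negP => s_gt0.
  by apply: pos; exists s; rewrite ?s_gt0.
move=> u /= /andP[u0 ut].
have : 0 < X w + B u w - l u.
  by rewrite ltNge; apply/negP => uE; apply: pos; exists u; rewrite ?u0.
have := nd _ _ (ltW u0); move: sE; rewrite s_eq0 B0; lra.
Unshelve. all: by end_near. Qed.

Lemma prob_hits_le_crosses l t : M_space l -> 0 < t ->
  fine (P (hits X B l t)) <= fine (P (crosses X B l t)).
Proof.
move=> Ml t0.
have mh := measurable_hits mB cB t mX Ml.
have mc := measurable_crosses mB cB t mX Ml.
rewrite fine_le ?fin_num_measure//.
rewrite -[leRHS]adde0 -(measure_negligible _ (hits_crosses_negligible Ml t0)); last first.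
  exact: measurableD.
apply: (le_trans _ (measureU2 _ _ _)) => //; last exact: measurableD.
apply: le_measure; rewrite ?inE//; first by apply: measurableU => //; exact: measurableD.
by move=> w wh; have [wc|nwc] := pselect (crosses X B l t w); [left|right].
Qed.

End no_touching.

(** * Lower semicontinuity of [Gamma] *)

Section lower_limit.
Context {R : realType} {d : measure_display} {Omega : measurableType d}.
Variables (P : probability Omega R) (B : R -> Omega -> R) (X : Omega -> R).
Hypothesis BM : brownian_motion P B.
Hypothesis mX : measurable_fun setT X.
Hypothesis indXB : independent_of_process P X B.

Let mB t : 0 <= t -> measurable_fun setT (B t).
Proof. by have [+ _ _ _ _] := BM; exact. Qed.

Let cB w : {within `[0, +oo[, continuous (B ^~ w)}.
Proof. by have [_ _ + _ _] := BM; exact. Qed.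

Variable alpha : R.
Hypothesis alpha_gt0 : 0 < alpha.

Lemma Gamma_lower_limit (x : R) (xs : nat -> R) l (ls : nat -> R -> R) s t e :
  M_space l -> (forall k, M_space (ls k)) ->
  (forall k, xs k.+1 <= xs k) -> (forall k u, ls k u <= ls k.+1 u) ->
  (forall e, 0 < e -> exists k, xs k <= x + e) ->
  (forall s t e, s < t -> 0 < e -> exists k, l s <= ls k t + e) ->
  s < t -> 0 < e ->
  exists k, Gamma P alpha (fun w => X w + x) B l s <=
    Gamma P alpha (fun w => X w + xs k) B (ls k) t + e.
Proof.
move=> Ml Mls xsS lsS xs_x l_ls st e0.
have mXc c : measurable_fun setT (fun w => X w + c) by exact: measurable_funD.
have xs_le m k : (m <= k)%N -> xs k <= xs m.
  by move=> mk; have /nonincreasing_seqP := xsS; exact.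
have ls_le m k u : (m <= k)%N -> ls m u <= ls k u.
  by move=> mk; have /nondecreasing_seqP := lsS^~ u; exact.
have [t0|t0] := leP t 0.
  have [_ _ ->] := Gamma_M P mB cB alpha_gt0 (mXc x) Ml; last exact: lt_le_trans t0.
  exists 0%N; apply: addr_ge0 (ltW e0).
  exact: M_ge0 (Gamma_M P mB cB alpha_gt0 (mXc _) (Mls _)) _.
(* Touching is negligible only up to a positive time, and room is needed between that time and
   [t]. *)
pose r := Num.max s (t / 2).
have r0 : 0 < r by rewrite lt_max orbC divr_gt0.
have sr : s <= r by rewrite le_max lexx.
have rt : r < t by rewrite gt_max st/=; lra.
have mH k : measurable (hits (fun w => X w + xs k) B (ls k) t) by exact: measurable_hits.
have HS k : hits (fun w => X w + xs k) B (ls k) t `<=`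
    hits (fun w => X w + xs k.+1) B (ls k.+1) t.
  by apply: hits_le => // w; rewrite lerD2l.
have [k kP] := fine_prob_bigcup P mH HS (divr_gt0 e0 alpha_gt0).
exists k; apply: (le_trans (Gamma_le P mB cB alpha_gt0 (mXc x) (mXc x) Ml Ml _ _ sr)) => //.
rewrite !GammaE// -lerBlDl -mulrBr mulrC -ler_pdivlMr// lerBlDl.
apply: (le_trans _ kP).
apply: (@le_trans _ _ (fine (P (crosses (fun w => X w + x) B l r)))).
  exact: (prob_hits_le_crosses BM (mXc x) (@independent_of_processD _ _ _ P B X x indXB) Ml r0).
apply: fine_prob_le; [exact: measurable_crosses|exact: bigcupT_measurable|].
move=> w [u /andP[u0 ur] uE].
(* A quarter of the depth of the crossing: moving [B], replacing [l] and replacing [x] cost at most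
   one quarter each. The later time [v] is needed because [l_ls] compares values at distinct times
   only. *)
pose c := (l u - (X w + x) - B u w) / 4.
have c0 : 0 < c by rewrite /c; lra.
have [dl dl0 db] := within_continuous_dist (@cB w) u0 c0.
have : u < Num.min t (u + dl) by rewrite lt_min ltrDl dl0 (le_lt_trans ur).
move=> /midf_lt[]; set v := _ / 2; rewrite lt_min => uv /andP[vt vd].
have v0 : 0 <= v := le_trans u0 (ltW uv).
have := db _ v0; rewrite ger0_norm ?subr_ge0 ?(ltW uv)// ltrBlDl => /(_ vd).
rewrite ltr_norml => /andP[_ bv].
have [k1 lk1] := l_ls _ _ _ uv c0; have [k2 xk2] := xs_x _ c0.
exists (maxn k1 k2) => //; exists v; first by rewrite v0 ltW.
have := ls_le _ _ v (leq_maxl k1 k2); have := xs_le _ _ (leq_maxr k1 k2).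
move: (maxn _ _) => n xn ln; move: bv lk1 xk2 xn ln; rewrite /c {c0 db}; lra.
Qed.
End lower_limit.

(** * Minimal solutions *)

Section minimal_solutions.
Context {R : realType} {d : measure_display} {Omega : measurableType d}.
Variables (P : probability Omega R) (alpha : R) (X0 : {RV P >-> R}).
Variables (B : R -> Omega -> R) (Lam : R -> R -> R).
Hypothesis alpha_gt0 : 0 < alpha.
Hypothesis BM : brownian_motion P B.
Hypothesis indXB : independent_of_process P X0 B.
Hypothesis Lam_minimal : forall x : R,
  minimal_MV_solution P alpha (fun w => X0 w + x) B (Lam x).

Let X x w := X0 w + x.

Let mB t : 0 <= t -> measurable_fun setT (B t).
Proof. by have [+ _ _ _ _] := BM; exact. Qed.

Let cB w : {within `[0, +oo[, continuous (B ^~ w)}.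
Proof. by have [_ _ + _ _] := BM; exact. Qed.

Let mX x : measurable_fun setT (X x).
Proof. exact: measurable_funD. Qed.

Let M_Lam x : M_space (Lam x).
Proof. by have [] := Lam_minimal x. Qed.

Let iterate x n := iter n (Gamma P alpha (X x) B) (cst 0).

Let M_iterate x n : M_space (iterate x n).
Proof. by elim: n => [|n IH]; [exact: M_cst0|exact: Gamma_M]. Qed.

Let Gamma_M' x l : M_space l -> M_space (Gamma P alpha (X x) B l).
Proof. exact: Gamma_M. Qed.

Let Gamma_mono x y l m s t : M_space l -> M_space m -> y <= x ->
  (forall u, l u <= m u) -> s <= t ->
  Gamma P alpha (X x) B l s <= Gamma P alpha (X y) B m t.
Proof.
by move=> Ml Mm yx lm st; apply: (Gamma_le P mB cB) => // w; rewrite lerD2l.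
Qed.

Let iterate_nd x n t : iterate x n t <= iterate x n.+1 t.
Proof.
elim: n t => [|n IH] t; first exact: M_ge0 (M_iterate x 1) t.
by apply: Gamma_mono => //; [exact: M_iterate|exact: (M_iterate x n.+1)].
Qed.

Let iterate_le x y n t : x <= y -> iterate y n t <= iterate x n t.
Proof.
move=> xy; elim: n t => [|n IH] t //=.
by apply: Gamma_mono => //; exact: M_iterate.
Qed.

Let iterate_cvg x : (forall n t, iterate x n t <= Lam x t) /\
  (forall s t e, s < t -> 0 < e -> exists n, Lam x s <= iterate x n t + e).
Proof.
have [_ cv] := Lam_minimal x.
by apply: M1_cvg_nondecreasing => //; exact: iterate_nd.
Qed.

Let le_right (c : R) (f : R -> R) s : M_space f ->
  (forall t e, s < t -> 0 < e -> c <= f t + e) -> c <= f s.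
Proof.
move=> Mf cf; apply/ler_addgt0Pr => e e0; have e2 : 0 < e / 2 by lra.
by have [u su fu] := M_right Mf s e2; have := cf _ _ su e2; lra.
Qed.

(** Each iterate lies below [Gamma] of the limit by monotonicity; conversely [Gamma_lower_limit]
    bounds [Gamma] of the limit by iterates. Right-continuity removes the time shifts. *)
Lemma minimal_MV_solution_eq x t : Lam x t = Gamma P alpha (X x) B (Lam x) t.
Proof.
have [le_Lam Lam_le] := iterate_cvg x.
apply/eqP; rewrite eq_le; apply/andP; split; apply: le_right => //.
- exact: Gamma_M'.
- move=> u e tu e0; have [n Lamn] := Lam_le _ _ _ tu e0.
  apply: (le_trans Lamn); rewrite lerD2r; apply: (le_trans (iterate_nd x n u)).
  by apply: Gamma_mono => //; exact: M_iterate.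
- move=> u e tu e0.
  have [k] : exists k, Gamma P alpha (X x) B (Lam x) t <=
      Gamma P alpha (X x) B (iterate x k) u + e.
    apply: (@Gamma_lower_limit _ _ _ P B X0 BM _ indXB _ alpha_gt0 x (fun=> x)) => //.
    + by move=> e'; exists 0%N; rewrite lerDl ltW.
  move=> /le_trans; apply; rewrite lerD2r.
  exact: (le_Lam k.+1).
Qed.

Lemma minimal_MV_solution_nonincreasing x y t : x <= y -> Lam y t <= Lam x t.
Proof.
move=> xy; apply: le_right => // u e tu e0.
have [n Lamn] := (iterate_cvg y).2 _ _ _ tu e0.
apply: (le_trans Lamn); rewrite lerD2r.
by apply: (le_trans (iterate_le n u xy)); exact: (iterate_cvg x).1.
Qed.

Let near_inv_natS (e : R) : 0 < e -> exists k, k.+1%:R^-1 < e.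
Proof.
move=> e0; near \oo => k; exists k; near: k; exact: near_infty_natSinv_lt (PosNum e0).
Unshelve. all: by end_near. Qed.

Let inv_natS_le (k m : nat) : (k <= m)%N -> m.+1%:R^-1 <= k.+1%:R^-1 :> R.
Proof. by move=> km; rewrite lef_pV2 ?posrE// ler_nat. Qed.

(** The upper bound is monotonicity in the shift. For the lower one, induction on [n] puts each
    iterate at [x] below the limit of [Lam (xs k)], as these are fixed points, and the iterates
    exhaust [Lam x]. *)
Lemma minimal_MV_solution_right_cvg x : M1_cvg (x^'+) Lam (Lam x).
Proof.
pose xs (k : nat) := x + k.+1%:R^-1.
have xsS k : xs k.+1 <= xs k by rewrite lerD2l inv_natS_le.
have lim_xs e : 0 < e -> exists k, xs k <= x + e.
  by move=> /near_inv_natS[k ke]; exists k; rewrite lerD2l ltW.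
have le_iterate n s t e : s < t -> 0 < e -> exists k, iterate x n s <= Lam (xs k) t + e.
  elim: n s t e => [|n IH] s t e st e0.
    by exists 0%N; have := M_ge0 (M_Lam (xs 0%N)) t; rewrite /iterate/=; lra.
  have [k Hk] : exists k, Gamma P alpha (X x) B (iterate x n) s <=
      Gamma P alpha (X (xs k)) B (Lam (xs k)) t + e.
    apply: (@Gamma_lower_limit _ _ _ P B X0 BM _ indXB _ alpha_gt0 x xs) => //.
    by move=> k u; exact: minimal_MV_solution_nonincreasing.
  by exists k; rewrite minimal_MV_solution_eq.
apply: M1_cvg_of_weak => // s t e st e0.
  near=> y; apply: (le_trans (_ : _ <= Lam x t)); last by rewrite lerDl ltW.
  have [_ nd _] := M_Lam x; apply: le_trans (nd _ _ (ltW st)).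
  apply: minimal_MV_solution_nonincreasing; apply: ltW.
  by near: y; exact: nbhs_right_gt.
have e2 : 0 < e / 2 by lra.
have [sm mt] := midf_lt st.
have [n Lamn] := (iterate_cvg x).2 _ _ _ sm e2.
have [k Lamk] := le_iterate n _ _ _ mt e2.
near=> y.
have : Lam (xs k) t <= Lam y t.
  apply: minimal_MV_solution_nonincreasing; apply: ltW.
  by near: y; apply: nbhs_right_lt; rewrite ltrDl.
lra.
Unshelve. all: by end_near. Qed.

Lemma minimal_MV_solution_left_cvg : exists Lam0 : R -> R,
  [/\ M_space Lam0, M1_cvg (0^'-) Lam Lam0 & MV_solution P alpha X0 B Lam0].
Proof.
pose xs (k : nat) : R := - k.+1%:R^-1.
have xs_lt0 k : xs k < 0 by rewrite oppr_lt0.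
have xs_le k m : (k <= m)%N -> xs k <= xs m by move=> km; rewrite lerN2 inv_natS_le.
(* An infimum of non-decreasing right-continuous paths is again right-continuous, so this pointwise
   limit lies in [M_space]. *)
pose Lam0 t := inf (range (fun k => Lam (xs k) t)).
have Lam0_inf t : has_inf (range (fun k => Lam (xs k) t)).
  by split; [exists (Lam (xs 0%N) t); exists 0%N|exists 0 => _ [k _ <-]; exact: M_ge0].
have Lam0_le t k : Lam0 t <= Lam (xs k) t.
  by apply: ge_inf; [case: (Lam0_inf t)|exists k].
have le_Lam0 t e : 0 < e -> exists k, Lam (xs k) t <= Lam0 t + e.
  move=> /inf_adherent/(_ (Lam0_inf t))[_ [k _ <-] /ltW kE]; by exists k.
have Lam0_nd s t : s <= t -> Lam0 s <= Lam0 t.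
  move=> st; apply/ler_addgt0Pr => e /(le_Lam0 t)[k /(le_trans _)]; apply.
  by apply: le_trans (Lam0_le s k) _; have [_ + _] := M_Lam (xs k); exact.
have MLam0 : M_space Lam0.
  apply: M_spaceI => [s t|t t0|t e e0]; first exact: Lam0_nd.
  - apply/eqP; rewrite eq_le; have [_ _ /(_ _ t0) E] := M_Lam (xs 0%N).
    rewrite -{1}E Lam0_le/=; apply: lb_le_inf; first by case: (Lam0_inf t).
    by move=> _ [k _ <-]; exact: M_ge0.
  - have e2 : 0 < e / 2 by lra.
    have [k kE] := le_Lam0 t _ e2; have [u tu uE] := M_right (M_Lam (xs k)) t e2.
    by exists u => //; have := Lam0_le u k; lra.
exists Lam0; split => //.
  apply: M1_cvg_of_weak => // s t e st e0.
    have [k kE] := le_Lam0 s _ e0; near=> y.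
    have : Lam y s <= Lam (xs k) s.
      apply: minimal_MV_solution_nonincreasing; apply: ltW.
      by near: y; exact: nbhs_left_gt.
    by have := Lam0_nd _ _ (ltW st); lra.
  near=> y; have y0 : y < 0 by near: y; exact: nbhs_left_lt.
  have [k ky] : exists k, k.+1%:R^-1 < - y by apply: near_inv_natS; rewrite oppr_gt0.
  have : Lam (xs k) t <= Lam y t.
    by apply: minimal_MV_solution_nonincreasing; rewrite lerNr ltW.
  have := Lam0_nd _ _ (ltW st); have := Lam0_le t k.
  by clear ky; lra.
split => // t t0; rewrite GammaE//.
pose H k := hits (X (xs k)) B (Lam (xs k)) t.
have mH k : measurable (H k) by exact: measurable_hits.
have HS k : H k.+1 `<=` H k.
  apply: hits_le => // [w|u]; first by rewrite lerD2l xs_le.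
  by apply: minimal_MV_solution_nonincreasing; exact: xs_le.
have LamE k : Lam (xs k) t = alpha * fine (P (H k)).
  by rewrite minimal_MV_solution_eq GammaE.
(* [nested_hits] provides one time that hits for every [k]; letting [k] grow at this fixed time
   gives a hit of the limit path. *)
have -> : hits X0 B Lam0 t = \bigcap_k H k.
  apply/seteqP; split => w.
    move=> wt k _; move: wt; apply: hits_le => //.
    by move=> v; rewrite /X; have := xs_lt0 k; lra.
  move=> Hw; have [||||s st sE] := @nested_hits R (B ^~ w) (fun k => Lam (xs k))
    (fun k => X (xs k) w) t (@cB w).
  - by [].
  - by move=> k m u mk; apply: minimal_MV_solution_nonincreasing; exact: xs_le.
  - by move=> k m mk; rewrite lerD2l xs_le.
  - by move=> k; exact: Hw.
  exists s => //; apply/ler_addgt0Pr => e e0; have e2 : 0 < e / 2 by lra.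
  have [k1 k1E] := le_Lam0 s _ e2; have [k2 k2E] := near_inv_natS e2.
  have := sE (maxn k1 k2); rewrite /X.
  have : Lam (xs (maxn k1 k2)) s <= Lam (xs k1) s.
    by apply: minimal_MV_solution_nonincreasing; apply: xs_le; exact: leq_maxl.
  have := xs_le _ _ (leq_maxr k1 k2).
  have : - (e / 2) < xs k2 by rewrite ltrN2.
  by clear k2E; move: (xs _) (xs _) => a b; lra.
(* Both sides are limits of [Lam (xs k) t = alpha * fine (P (H k))]: the left one by definition of
   [Lam0], the right one by continuity from above. *)
apply/eqP; rewrite eq_le; apply/andP; split; apply/ler_addgt0Pr => e e0.
  have [k kE] := fine_prob_bigcap P mH HS (divr_gt0 e0 alpha_gt0).
  apply: le_trans (Lam0_le t k) _; rewrite LamE -lerBlDl -mulrBr mulrC.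
  by rewrite -ler_pdivlMr// lerBlDl.
have [k kE] := le_Lam0 t _ e0; apply: le_trans kE; rewrite LamE ler_pM2l//.
apply: fine_prob_le => //; first exact: bigcapT_measurable.
by move=> w; exact.
Unshelve. all: by end_near. Qed.

End minimal_solutions.

Theorem theorem1p6 (R : realType) (d : measure_display)
    (Omega : measurableType d) (P : probability Omega R) (alpha : R)
    (X0 : {RV P >-> R}) (B : R -> Omega -> R) (Lam : R -> R -> R)
    (alpha_gt0 : 0 < alpha)
    (B_brownian : brownian_motion P B)
    (X0_B_independent : independent_of_process P X0 B)
    (X0_integrable : P.-integrable setT (EFin \o X0))
    (Lam_minimal : forall x : R,
      minimal_MV_solution P alpha (fun w => X0 w + x) B (Lam x)) :
  (forall x : R, M1_cvg (x^'+) Lam (Lam x)) /\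
  (exists Lam0 : R -> R,
    [/\ M_space Lam0, M1_cvg (0^'-) Lam Lam0
      & MV_solution P alpha X0 B Lam0]).
Proof.
split; first exact: (@minimal_MV_solution_right_cvg _ _ _ P alpha X0 B Lam alpha_gt0
  B_brownian X0_B_independent Lam_minimal).
exact: (@minimal_MV_solution_left_cvg _ _ _ P alpha X0 B Lam alpha_gt0
  B_brownian X0_B_independent Lam_minimal).
Qed.
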